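(* There exists a sequence of normalized triples $(\mathbb C,f_n,0)$, $n\in\mathbb N$, where each $f_n$ is an entire function of infinite order, that converges in the sense of Carathéodory to a normalized triple $(\mathbb C,f,0)$ in which $f$ is an entire function of order $1$.
   Context: A surface spread over the sphere is a pair $(S,f)$ with $S$ an open topological surface and $f:S\to\hat{\mathbb C}$ continuous, open and discrete. A pointed surface is $(S,f,w)$ with $w$ not a critical point of $f$. A triple is normalized if $S=D_R=\{|z|<R\}$ for some $R\in(0,+\infty]$ (so $D_\infty=\mathbb C$), $w=0$ and $f^{\#}(0)=1$ where $f^{\#}=f'/(1+|f|^2)$. $(S_1,f_1,w_1)\sim(S_2,f_2,w_2)$ if there is a homeomorphism $h$ with $h(w_1)=w_2$, $f_1=f_2\circ h$; $(S_1,f_1,w_1)\subset(S_2,f_2,w_2)$ if there is a continuous injective $\phi$ with $\phi(w_1)=w_2$, $f_1=f_2\circ\phi$; $T$ is maximal if $T\subset T_1$ implies $T\sim T_1$. Standing assumption on sequences: there exist $p\in\hat{\mathbb C}$, $r>0$ and domains $W_n\ni w_n$ with $f_n(w_n)=p$ and $f_n:W_n\to B(p,r)$ a homeomorphism. A kernel of $(S_n,f_n,w_n)$ is a pointed $(S,f,w)$ such that (1) there is a discrete $E\subset S$, $w\notin E$, such that for every compact $K\subset S\setminus E$ with $w\in K$ there is $N$ such that for all $n>N$ there is a continuous embedding $\phi_{K,n}:K\to S_n$ with $\phi_{K,n}(w)=w_n$ and $f_n\circ\phi_{K,n}=f$ on $K$; (2) the triple satisfying (1) is maximal in the sense of $\subset$.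 The sequence converges in the sense of Carathéodory to $(S,f,w)$ if $(S,f,w)$ is a kernel of every subsequence. *)

(* Defs.v *)
(* The complex plane is modelled as R[i] for an
   arbitrary R : realType (all realTypes are isomorphic to the reals). *)
From HB Require Import structures.
From mathcomp Require Import all_boot all_order all_algebra.
From mathcomp Require Import all_classical all_reals all_analysis.
From mathcomp.real_closed Require Import complex.
Export numFieldNormedType.Exports.
Import Order.TTheory GRing.Theory Num.Theory.

Set Implicit Arguments.
Unset Strict Implicit.
Unset Printing Implicit Defensive.

Local Open Scope ring_scope.
Local Open Scope classical_set_scope.

Definition CC (R : realType) : numClosedFieldType := R[i].

Definition cabs (R : realType) (z : CC R) : R := ComplexField.Normc.normc z.

(* the Riemann sphere \hat C = C u {oo}, as the one-point compactification;
   [None] is the point at infinity *)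
Definition Chat (R : realType) : topologicalType :=
  one_point_compactification (CC R).

Definition chordal (R : realType) (p q : Chat R) : R :=
  match p, q with
  | Some a, Some b =>
      2 * cabs (a - b) / Num.sqrt ((1 + cabs a ^+ 2) * (1 + cabs b ^+ 2))
  | Some a, None => 2 / Num.sqrt (1 + cabs a ^+ 2)
  | None, Some b => 2 / Num.sqrt (1 + cabs b ^+ 2)
  | None, None => 0
  end.

Definition sph_ball (R : realType) (p : Chat R) (r : R) : set (Chat R) :=
  [set q | chordal p q < r].

Definition homeo_onto (S T : topologicalType) (U : set S) (V : set T)
    (g : S -> T) : Prop :=
  exists h : T -> S,
    [/\ {within U, continuous g}, {within V, continuous h}, g @` U = V,
        (forall x, U x -> h (g x) = x) & (forall y, V y -> g (h y) = y)].

Definition open_surface (R : realType) (S : topologicalType) : Prop :=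
  [/\ hausdorff_space S, second_countable (T := S),
      connected [set: S], ~ compact [set: S] &
      forall x : S, exists (U : set S) (V : set (CC R)) (g : S -> CC R),
        [/\ open U, U x, open V & homeo_onto U V g]].

Definition open_map (S T : topologicalType) (f : S -> T) : Prop :=
  forall A : set S, open A -> open (f @` A).

Definition discrete_map (S T : topologicalType) (f : S -> T) : Prop :=
  forall x : S, exists U : set S,
    nbhs x U /\ (forall y, U y -> f y = f x -> y = x).

Definition spread_surface (R : realType) (S : topologicalType)
    (f : S -> Chat R) : Prop :=
  [/\ open_surface R S, continuous f, open_map f & discrete_map f].

Definition noncritical (S T : topologicalType) (f : S -> T) (w : S) : Prop :=
  exists U : set S, nbhs w U /\
    (forall x y, U x -> U y -> f x = f y -> x = y).

Record triple (R : realType) := Triple {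
  tS : topologicalType;
  tf : tS -> Chat R;
  tw : tS }.
Arguments tS {R} t.
Arguments tf {R} t _.
Arguments tw {R} t.

Definition pointed_surface (R : realType) (T : triple R) : Prop :=
  spread_surface (tf T) /\ noncritical (tf T) (tw T).

Definition homeomorphism (S T : topologicalType) (h : S -> T) : Prop :=
  exists g : T -> S,
    [/\ continuous h, continuous g, cancel h g & cancel g h].

Definition triple_equiv (R : realType) (T1 T2 : triple R) : Prop :=
  exists h : tS T1 -> tS T2,
    [/\ homeomorphism h, h (tw T1) = tw T2 &
        forall x, tf T1 x = tf T2 (h x)].

Definition triple_sub (R : realType) (T1 T2 : triple R) : Prop :=
  exists phi : tS T1 -> tS T2,
    [/\ continuous phi, injective phi, phi (tw T1) = tw T2 &
        forall x, tf T1 x = tf T2 (phi x)].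

Definition discrete_subset (S : topologicalType) (E : set S) : Prop :=
  forall x : S, exists U : set S, nbhs x U /\ (forall y, U y -> E y -> y = x).

Definition embedding_on (S S' : topologicalType) (K : set S)
    (phi : S -> S') : Prop :=
  [/\ {within K, continuous phi},
      (forall x y, K x -> K y -> phi x = phi y -> x = y) &
      exists psi : S' -> S,
        {within phi @` K, continuous psi} /\ (forall x, K x -> psi (phi x) = x)].

Definition kernel_cond1 (R : realType) (Tn : nat -> triple R) (T : triple R)
    : Prop :=
  exists E : set (tS T),
    [/\ discrete_subset E, ~ E (tw T) &
      forall K : set (tS T), compact K -> K `<=` ~` E -> K (tw T) ->
        exists N : nat, forall n : nat, (N < n)%N ->
          exists phi : tS T -> tS (Tn n),
            [/\ embedding_on K phi, phi (tw T) = tw (Tn n) &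
                forall x, K x -> tf (Tn n) (phi x) = tf T x]].

Definition is_kernel (R : realType) (Tn : nat -> triple R) (T : triple R)
    : Prop :=
  [/\ pointed_surface T, kernel_cond1 Tn T &
      forall T1 : triple R, pointed_surface T1 -> kernel_cond1 Tn T1 ->
        triple_sub T T1 -> triple_equiv T T1].

Definition standing_assumption (R : realType) (Tn : nat -> triple R) : Prop :=
  (forall n, pointed_surface (Tn n)) /\
  exists (p : Chat R) (r : R), 0 < r /\
    forall n, exists W : set (tS (Tn n)),
      [/\ open W, connected W, W (tw (Tn n)), tf (Tn n) (tw (Tn n)) = p &
          homeo_onto W (sph_ball p r) (tf (Tn n))].

Definition caratheodory_converges (R : realType) (Tn : nat -> triple R)
    (T : triple R) : Prop :=
  standing_assumption Tn /\
  forall sigma : nat -> nat, (forall k, (sigma k < sigma k.+1)%N) ->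
    is_kernel (fun k => Tn (sigma k)) T.

Definition entire (R : realType) (f : CC R -> CC R) : Prop :=
  forall z : CC R, derivable f z 1.

Definition max_modulus (R : realType) (f : CC R -> CC R) (r : R) : R :=
  sup [set cabs (f z) | z in [set z : CC R | cabs z = r]].

Definition entire_order (R : realType) (f : CC R -> CC R) : \bar R :=
  limf_esup (fun r : R => (ln (ln (max_modulus f r)) / ln r)%:E)
            (pinfty_nbhs R).

Definition plane_triple (R : realType) (f : CC R -> CC R) : triple R :=
  @Triple R (CC R) (fun z => Some (f z)) 0.

Definition sph_deriv (R : realType) (f : CC R -> CC R) (z : CC R) : CC R :=
  'D_1 f z / (1 + `|f z| ^+ 2).

(* (C, f, 0) is a normalized triple (here R = +oo, D_R = C, w = 0) *)
Definition normalized_plane (R : realType) (f : CC R -> CC R) : Prop :=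
  pointed_surface (plane_triple f) /\ sph_deriv f 0 = 1.

(* Main.v *)
Require Import Defs.
From HB Require Import structures.
From mathcomp Require Import all_boot all_order all_algebra.
From mathcomp Require Import all_classical all_reals all_analysis.
From mathcomp.real_closed Require Import complex.
Import Order.TTheory GRing.Theory Num.Theory.
From mathcomp Require Import ring lra.
Set Implicit Arguments.
Unset Strict Implicit.
Unset Printing Implicit Defensive.
Local Open Scope ring_scope.
Local Open Scope classical_set_scope.

(** Take [f z = exp (2 z)] and [f_n z = exp (2 g_n z)] with
    [g_n z = (n + 1) (exp (z / (n + 1)) - 1)].  The branch [(n + 1) log (1 + w / (n + 1))] of
    the inverse of [g_n] is defined for [Re w > - (n + 1)], a half-plane that eventually
    contains any compact set; it embeds that set in the plane and intertwines [f] and [f_n].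

    For maximality, let [phi] embed [(C, f, 0)] in [(S, f1, w1)], also a limit of the [f_n].
    Off a discrete set [f1] is locally injective, because the [f_n] are, and [phi] is then
    open.  Its image is closed: let [x0] be in the closure and [a = f1 x0].  If [a] is finite
    and nonzero, a branch of [log / 2] near [a], composed with [phi], passes through [x0].  If
    [a] is 0 or infinity, then [phi] maps a half-plane into a compact neighbourhood of [x0];
    this half-plane is invariant under the period of [f], so that a fibre of the discrete
    map [f1] would have infinitely many points in a compact set. *)

(** * The plane in real coordinates *)

Section complex_plane.
Variable R : realType.
Implicit Types (z w : CC R) (x y a b e : R).

Definition mkC x y : CC R := Complex x y.
Definition cre z : R := complex.Re z.
Definition cim z : R := complex.Im z.

Lemma mkCK z : mkC (cre z) (cim z) = z.
Proof. by case: z. Qed.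

Lemma eq_creim z w : cre z = cre w -> cim z = cim w -> z = w.
Proof. by case: z w => [a b] [c d] /= -> ->. Qed.

Lemma creD z w : cre (z + w) = cre z + cre w. Proof. by case: z w => ? ? []. Qed.
Lemma cimD z w : cim (z + w) = cim z + cim w. Proof. by case: z w => ? ? []. Qed.
Lemma creN z : cre (- z) = - cre z. Proof. by case: z. Qed.
Lemma cimN z : cim (- z) = - cim z. Proof. by case: z. Qed.
Lemma creM z w : cre (z * w) = cre z * cre w - cim z * cim w.
Proof. by case: z w => ? ? []. Qed.
Lemma cimM z w : cim (z * w) = cre z * cim w + cim z * cre w.
Proof. by case: z w => ? ? []. Qed.

Lemma cabsE z : cabs z = Num.sqrt (cre z ^+ 2 + cim z ^+ 2).
Proof. by case: z. Qed.
Lemma normC_cabs z : `|z| = (cabs z)%:C%C.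
Proof. by rewrite normc_def cabsE. Qed.
Lemma cabs_ge0 z : 0 <= cabs z. Proof. by rewrite cabsE sqrtr_ge0. Qed.
Lemma cabs_sqr z : cabs z ^+ 2 = cre z ^+ 2 + cim z ^+ 2.
Proof. by rewrite cabsE sqr_sqrtr// addr_ge0// sqr_ge0. Qed.
Lemma cabsM z w : cabs (z * w) = cabs z * cabs w.
Proof. exact: ComplexField.Normc.normcM. Qed.
Lemma cabsV z : cabs z^-1 = (cabs z)^-1.
Proof.
have [->|z0] := eqVneq z 0; first by rewrite invr0 cabsE /= expr0n addr0 sqrtr0 invr0.
have c0 : cabs z != 0 by apply: contra_neq z0 => /ComplexField.Normc.eq0_normc.
apply: (mulfI c0); rewrite -cabsM !mulfV//; exact: ComplexField.Normc.normc1.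
Qed.
Lemma cabsN z : cabs (- z) = cabs z.
Proof. by rewrite !cabsE creN cimN !sqrrN. Qed.

Lemma cabs_gt0 z : z != 0 -> 0 < cabs z.
Proof.
move=> z0; rewrite lt_neqAle cabs_ge0 andbT eq_sym.
by apply: contra_neq z0 => /ComplexField.Normc.eq0_normc.
Qed.

Lemma cabs_le z : cabs z <= `|cre z| + `|cim z|.
Proof.
rewrite -(@ler_pXn2r _ 2)// ?nnegrE ?cabs_ge0 ?addr_ge0//.
rewrite cabs_sqr -(real_normK (num_real (cre z))) -(real_normK (num_real (cim z))).
by have := normr_ge0 (cre z); have := normr_ge0 (cim z); nra.
Qed.
Lemma cre_le z : `|cre z| <= cabs z.
Proof.
rewrite -(@ler_pXn2r _ 2)// ?nnegrE ?cabs_ge0//.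
by rewrite cabs_sqr real_normK ?num_real// lerDl sqr_ge0.
Qed.
Lemma cim_le z : `|cim z| <= cabs z.
Proof.
rewrite -(@ler_pXn2r _ 2)// ?nnegrE ?cabs_ge0//.
by rewrite cabs_sqr real_normK ?num_real// lerDr sqr_ge0.
Qed.

(** The norm on [CC R] takes values in [CC R], so balls have complex radii; positivity forces such a
    radius to be real, which permits real radii and [cabs] from here on. *)
Lemma nbhs_cabsP z (A : set (CC R)) :
  nbhs z A <-> exists2 e : R, 0 < e & forall w, cabs (w - z) < e -> A w.
Proof.
split=> [|[e e0 H]].
  move=> /nbhs_ballP[[e e'] /= e0 H].
  move: e0; rewrite ltcE/= => /andP[/eqP e'0 e0]; exists e => // w zw.
  apply: H; rewrite -ball_normE/= distrC normC_cabs e'0.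
  by rewrite ltcE/= eqxx.
apply/nbhs_ballP; exists (e%:C)%C => /=; first by rewrite ltcE/= eqxx.
move=> w; rewrite -ball_normE/= distrC normC_cabs ltcE/= => /andP[_]; exact: H.
Qed.

Lemma continuous_cre : continuous cre.
Proof.
move=> z A /nbhs_ballP[e /= e0 H].
suff : nbhs z (cre @^-1` A) by [].
apply/nbhs_cabsP; exists e => // w we; apply: H; rewrite -ball_normE/=.
by rewrite distrC -creN -creD (le_lt_trans (cre_le _)).
Qed.

Lemma continuous_cim : continuous cim.
Proof.
move=> z A /nbhs_ballP[e /= e0 H].
suff : nbhs z (cim @^-1` A) by [].
apply/nbhs_cabsP; exists e => // w we; apply: H; rewrite -ball_normE/=.
by rewrite distrC -cimN -cimD (le_lt_trans (cim_le _)).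
Qed.

Lemma cvg_mkC (T : Type) (F : set_system T) (f g : T -> R) x y :
  Filter F -> f @ F --> x -> g @ F --> y -> (fun t => mkC (f t) (g t)) @ F --> mkC x y.
Proof.
move=> FF fx gy A /nbhs_cabsP[e e0 H]; rewrite /= nbhs_filterE /=.
have e2 : 0 < e / 2 by rewrite divr_gt0.
move/cvgrPdist_lt : fx => /(_ _ e2) fx; move/cvgrPdist_lt : gy => /(_ _ e2) gy.
apply: filterS2 fx gy => t xt yt; apply: H.
apply: le_lt_trans (cabs_le _) _.
rewrite creD creN cimD cimN [`|f t - _|]distrC [`|g t - _|]distrC.
by rewrite [e]splitr ltrD.
Qed.

Lemma continuous_mkC (T : topologicalType) (f g : T -> R) t :
  {for t, continuous f} -> {for t, continuous g} ->
  {for t, continuous (fun t => mkC (f t) (g t))}.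
Proof. by move=> cf cg; apply: cvg_mkC. Qed.

Lemma continuous_cabs : continuous (@cabs R).
Proof.
move=> z; rewrite (_ : @cabs R = fun z => Num.sqrt (cre z * cre z + cim z * cim z)); last first.
  by apply/funext => w; rewrite cabsE !expr2.
apply: (@continuous_comp _ _ _ (fun z => cre z * cre z + cim z * cim z) Num.sqrt);
  last exact: sqrt_continuous.
by apply: continuousD; apply: continuousM; (exact: continuous_cre || exact: continuous_cim).
Qed.

Lemma CC_hausdorff : hausdorff_space (CC R).
Proof. exact: norm_hausdorff. Qed.

(** Closed squares stand in for closed discs: each is the image of a product of two segments, hence
    compact. *)
Definition csquare z e : set (CC R) :=
  [set w | `|cre w - cre z| <= e /\ `|cim w - cim z| <= e].

Lemma compact_csquare z e : compact (csquare z e).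
Proof.
have -> : csquare z e =
    (fun p : R * R => mkC p.1 p.2) @`
       (`[cre z - e, cre z + e] `*` `[cim z - e, cim z + e]).
  apply/seteqP; split=> [w [wr wi]|_ [[x y] [/= xz yz] <-]].
    exists (cre w, cim w); last by rewrite mkCK.
    by split; rewrite /= in_itv/= -ler_distl.
  by move: xz yz; rewrite /= !in_itv/= -!ler_distl.
apply: continuous_compact.
  apply: continuous_subspaceT => p.
  by apply: continuous_mkC; [exact: cvg_fst|exact: cvg_snd].
by apply: compact_setX; exact: segment_compact.
Qed.

Lemma nbhs_csquare z e : 0 < e -> nbhs z (csquare z e).
Proof.
move=> e0; apply/nbhs_cabsP; exists e => // w /ltW we; split.
  by rewrite -creN -creD (le_trans (cre_le _)).
by rewrite -cimN -cimD (le_trans (cim_le _)).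
Qed.

Lemma nbhs_csquareP z (A : set (CC R)) : nbhs z A ->
  exists2 e : R, 0 < e & csquare z e `<=` A.
Proof.
move=> /nbhs_cabsP[e e0 H]; exists (e / 3); first by rewrite divr_gt0.
move=> w [wr wi]; apply: H; apply: le_lt_trans (cabs_le _) _.
by rewrite creD creN cimD cimN; lra.
Qed.

Lemma compact_cabs_bounded (K : set (CC R)) : compact K ->
  exists M : nat, forall z, K z -> cabs z < M%:R.
Proof.
move=> cK.
have : compact [set cabs z | z in K].
  by apply: continuous_compact => //; apply: continuous_subspaceT; exact: continuous_cabs.
move=> /compact_bounded [M [_ HM]].
exists (Num.bound (M + 1)) => z Kz.
have zM := HM (M + 1) ltac:(by rewrite ltrDl) (cabs z) (ex_intro2 _ _ z Kz erefl).
apply: le_lt_trans (archi_boundP _); last exact: le_trans zM.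
by apply: le_trans zM; rewrite ler_norm.
Qed.

Lemma CC_not_compact : ~ compact [set: CC R].
Proof.
move=> /compact_cabs_bounded[M /(_ (mkC M%:R 0) I)].
by rewrite cabsE /= expr0n addr0 sqrtr_sqr ger0_norm// ltxx.
Qed.

Lemma CC_second_countable : second_countable (T := CC R).
Proof.
pose B (p : rat * rat * rat) : set (CC R) :=
  [set w | `|cre w - ratr p.1.1| < ratr p.2 /\ `|cim w - ratr p.1.2| < ratr p.2].
have oB p : open (B p).
  have -> : B p = cre @^-1` [set x | `|x - ratr p.1.1| < ratr p.2] `&`
                  cim @^-1` [set x | `|x - ratr p.1.2| < ratr p.2] by [].
  apply: openI; apply: open_comp; [by move=> ? _; exact: continuous_cre| |
    by move=> ? _; exact: continuous_cim|];
  apply: (@open_comp _ _ (fun x : R => `|x - _|) [set x : R | x < _]);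
  rewrite ?open_lt// => x _; apply: cvg_norm; apply: cvgB => //; exact: cvg_cst.
exists (range B).
  exact: (card_le_trans (card_image_le _ _) (countableP (setT : set (rat * rat * rat)))).
split; first by move=> _ [p _ <-].
move=> z A /nbhs_cabsP[e e0 H].
(* The rational centre is taken within [q] of [z] in each coordinate, so the square of half-side [q]
   contains [z] and stays within [2 * q < e / 2] of it in each coordinate. *)
have [q q0 qe] : exists2 q : rat, 0 < (ratr q : R) & ratr q < e / 4.
  by have [q] := @rat_in_itvoo R 0 (e / 4) ltac:(lra); rewrite in_itv/= => /andP[]; exists q.
have [x] := @rat_in_itvoo R (cre z - ratr q) (cre z) ltac:(lra).
have [y] := @rat_in_itvoo R (cim z - ratr q) (cim z) ltac:(lra).
rewrite !in_itv/= => /andP[y1 y2] /andP[x1 x2].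
exists (B (x, y, q)) => /=.
  by split; [exists (x, y, q)|split => /=; rewrite ger0_norm; lra].
move=> w [/=]; rewrite !ltr_norml => /andP[w1 w2] /andP[w3 w4]; apply: H.
apply: le_lt_trans (cabs_le _) _; rewrite creD creN cimD cimN.
have : `|cre w - cre z| < e / 2 by rewrite ltr_norml; lra.
have : `|cim w - cim z| < e / 2 by rewrite ltr_norml; lra.
lra.
Qed.

Definition csegment z w t : CC R :=
  mkC (cre z + t * (cre w - cre z)) (cim z + t * (cim w - cim z)).

(** Such a set is a union of segments, each connected, sharing the point [z]. *)
Lemma star_connected z (A : set (CC R)) : A z ->
  (forall w t, A w -> 0 <= t <= 1 -> A (csegment z w t)) -> connected A.
Proof.
move=> Az H.
have -> : A = \bigcup_(w in A) (csegment z w @` `[0, 1]).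
  apply/seteqP; split=> [w Aw|w [v Av [t]]]; last first.
    by rewrite /= in_itv/= => t01 <-; exact: H.
  exists w => //; exists 1; first by rewrite /= in_itv/= ler01 lexx.
  by rewrite /csegment !mul1r !subrKC mkCK.
apply: bigcup_connected.
  exists z => w Aw; exists 0; first by rewrite /= in_itv/= ler01 lexx.
  by rewrite /csegment !mul0r !addr0 mkCK.
move=> w _; apply: connected_continuous_connected; first exact: segment_connected.
apply: continuous_subspaceT => t.
have c (a b : R) : {for t, continuous (fun u : R => a + u * b)}.
  by apply: continuousD; [exact: cvg_cst|apply: continuousM; [exact: cvg_id|exact: cvg_cst]].
exact: (continuous_mkC (c _ _) (c _ _)).
Qed.

Lemma CC_connected : connected [set: CC R].
Proof. exact: (@star_connected 0). Qed.

Lemma CC_open_surface : open_surface R (CC R).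
Proof.
split; [exact: CC_hausdorff|exact: CC_second_countable|exact: CC_connected|
        exact: CC_not_compact|move=> x].
exists setT, setT, id; split; [exact: openT|by []|exact: openT|].
have cid : {within [set: CC R], continuous (@id (CC R))}.
  by apply: continuous_subspaceT => z; exact: cvg_id.
by exists id; split; rewrite ?image_id.
Qed.

End complex_plane.

(** * Exponential and logarithm *)

Section real_estimates.
Variable R : realType.
Implicit Types a b x : R.

(** Serves both signs of [x]. For [sin] and [cos], each bound below controls the derivative in the
    next one and so raises its order. *)
Lemma MVT0 (f df : R -> R) x : (forall u : R, is_derive (u : R) (1 : R) f (df u)) ->
  exists2 c, `|c| <= `|x| & f x - f 0 = df c * x.
Proof.
move=> Hf.
have cf a b : {within `[a, b], continuous f}.
  apply: continuous_subspaceT => u.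
  by apply/differentiable_continuous/derivable1_diffP; apply: ex_derive.
have [x0|x0] := leP 0 x.
  have [c] := MVT_segment x0 (fun u _ => Hf u) (cf _ _).
  rewrite in_itv/= subr0 => /andP[c0 cx] ->; exists c => //.
  by rewrite !ger0_norm.
have [c] := MVT_segment (ltW x0) (fun u _ => Hf u) (cf _ _).
rewrite in_itv/= sub0r => /andP[c0 cx] E; exists c.
  by rewrite ler0_norm// ltr0_norm// lerN2.
by rewrite -opprB E mulrN opprK.
Qed.

Lemma sin_le_norm x : `|sin x| <= `|x|.
Proof.
have [c _] := @MVT0 sin cos x (fun u => is_derive_sin u).
by rewrite sin0 subr0 => ->; rewrite normrM ler_piMl// cos_max.
Qed.

Lemma cosB1_le x : `|cos x - 1| <= x ^+ 2.
Proof.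
have [c cx] := @MVT0 cos (fun u => - sin u) x (fun u => is_derive_cos u).
rewrite cos0 => ->; rewrite normrM normrN -real_normK ?num_real// expr2.
by rewrite ler_wpM2r// (le_trans (sin_le_norm _)).
Qed.

Lemma sinBid_le x : `|x| <= 1 -> `|sin x - x| <= x ^+ 2.
Proof.
move=> x1.
have D (u : R) : is_derive (u : R) (1 : R) (fun u : R => sin u - u) (cos u - 1).
  exact: (@is_deriveB R R R sin id u 1 _ _ (is_derive_sin u) (is_derive_id u 1)).
have [c cx] := @MVT0 _ _ x D.
rewrite sin0 !subr0 => ->; rewrite normrM.
apply: (@le_trans _ _ (x ^+ 2 * 1)); last by rewrite mulr1.
apply: ler_pM => //; apply: le_trans (cosB1_le _) _.
by rewrite -real_normK ?num_real// -[leRHS]real_normK ?num_real// lerXn2r// nnegrE.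
Qed.

(** The inequality [1 + x <= expR x] gives the lower bound; taken at [- x] it gives
    [expR x * (1 - x) <= 1], and [1 - x >= 1/2] then bounds the excess. *)
Lemma expRB1Bid_le x : `|x| <= 2^-1 -> `|expR x - 1 - x| <= 2 * x ^+ 2.
Proof.
move=> x2; have x1 := ler_norm x; have x1' := ler_norm (- x); rewrite normrN in x1'.
have A := expR_ge1Dx x; have B := expR_ge1Dx (- x).
have E := expRxMexpNx_1 x; have E0 := expR_gt0 x; have E0' := expR_gt0 (- x).
rewrite ger0_norm; last lra.
have : expR x * (1 - x) <= 1 by rewrite -E; apply: ler_wpM2l; lra.
by nra.
Qed.
End real_estimates.

Section complex_exponential.
Variable R : realType.
Implicit Types (z w h a : CC R).

Definition cexp z : CC R :=
  mkC (expR (cre z) * cos (cim z)) (expR (cre z) * sin (cim z)).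

Lemma cexp0 : cexp 0 = 1.
Proof. by rewrite /cexp /= expR0 cos0 sin0 mulr1 mulr0. Qed.

Lemma cexpD z w : cexp (z + w) = cexp z * cexp w.
Proof.
apply: eq_creim; rewrite ?creM ?cimM /= creD cimD expRD ?sinD ?cosD; ring.
Qed.

Lemma cexp_neq0 z : cexp z != 0.
Proof.
apply/eqP => E; have : cexp (z - z) = 0 by rewrite cexpD E mul0r.
by rewrite subrr cexp0; apply/eqP; rewrite oner_eq0.
Qed.

Lemma cexpN z : cexp (- z) = (cexp z)^-1.
Proof.
apply: (mulfI (cexp_neq0 z)); rewrite mulfV ?cexp_neq0//.
by rewrite -cexpD subrr cexp0.
Qed.

Lemma cexpB z w : cexp (z - w) = cexp z / cexp w.
Proof. by rewrite cexpD cexpN. Qed.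

Lemma cabs_cexp z : cabs (cexp z) = expR (cre z).
Proof.
rewrite cabsE /= !exprMn -mulrDr cos2Dsin2 mulr1 sqrtr_sqr.
by rewrite ger0_norm// expR_ge0.
Qed.

Lemma cexp_pi : cexp (mkC 0 pi) = -1.
Proof. by rewrite /cexp /= expR0 !mul1r cospi sinpi; apply: eq_creim => //=; rewrite oppr0. Qed.

Lemma cexp_pihalf : cexp (mkC 0 (pi / 2)) = mkC 0 1.
Proof. by rewrite /cexp /= expR0 !mul1r cos_pihalf sin_pihalf. Qed.

Lemma cexp_period z k : cexp (z + mkC 0 (k%:R * (pi *+ 2))) = cexp z.
Proof.
rewrite cexpD; suff -> : cexp (mkC 0 (k%:R * (pi *+ 2))) = 1 by rewrite mulr1.
elim: k => [|k IH]; first by rewrite mul0r cexp0.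
have -> : mkC 0 (k.+1%:R * (pi *+ 2)) =
    mkC 0 (k%:R * (pi *+ 2)) + (mkC 0 pi + mkC 0 pi) :> CC R.
  by rewrite -(natr1 k) mulrDl mul1r; apply: eq_creim; rewrite !(creD, cimD) /= ?addr0 -?mulr2n.
by rewrite !cexpD IH cexp_pi mul1r mulrNN mulr1.
Qed.

(** The modulus forces the real part to be 0, and [sin] vanishes in the open interval from [-pi] to
    [pi] only at 0. *)
Lemma cexp_eq1 z : `|cim z| < pi -> cexp z = 1 -> z = 0.
Proof.
rewrite ltr_norml => /andP[z1 z2] E.
have r0 : cre z = 0.
  apply: (@expR_inj R); rewrite expR0 -cabs_cexp E; exact: ComplexField.Normc.normc1.
have : sin (cim z) = 0.
  by have := congr1 (@cim R) E; rewrite /= r0 expR0 mul1r.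
move=> s0; apply: eq_creim => //; have [i0|i0|//] := ltgtP (cim z) 0.
  have : 0 < sin (- cim z) by rewrite sin_gt0_pi// oppr_gt0 i0 ltrNl.
  by rewrite sinN s0 oppr0 ltxx.
have : 0 < sin (cim z) by rewrite sin_gt0_pi// i0.
by rewrite s0 ltxx.
Qed.

Lemma cexp_inj z w : `|cim z - cim w| < pi -> cexp z = cexp w -> z = w.
Proof.
move=> zw E; apply/eqP; rewrite -subr_eq0; apply/eqP/cexp_eq1.
  by rewrite cimD cimN.
by rewrite cexpB E divff ?cexp_neq0.
Qed.

Lemma continuous_cexp : continuous cexp.
Proof.
move=> z; apply: (@continuous_mkC R _ (fun z => expR (cre z) * cos (cim z))
  (fun z => expR (cre z) * sin (cim z))); apply: continuousM.
- apply: (@continuous_comp _ _ _ (@cre R) (@expR R)); [exact: continuous_cre|exact: continuous_expR].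
- apply: (@continuous_comp _ _ _ (@cim R) (@cos R)); [exact: continuous_cim|exact: continuous_cos].
- apply: (@continuous_comp _ _ _ (@cre R) (@expR R)); [exact: continuous_cre|exact: continuous_expR].
- apply: (@continuous_comp _ _ _ (@cim R) (@sin R)); [exact: continuous_cim|exact: continuous_sin].
Qed.

(** The principal logarithm, correct on the right half-plane only: there [atan (cim w / cre w)] is
    the argument. *)
Definition clog w : CC R := mkC (ln (cabs w)) (atan (cim w / cre w)).

Lemma clogK w : 0 < cre w -> cexp (clog w) = w.
Proof.
move=> w0; set t := cim w / cre w.
have wn : w != 0 by apply: contraTneq w0 => ->; rewrite ltxx.
have s0 : 0 < Num.sqrt (1 + t ^+ 2) by rewrite sqrtr_gt0 ltr_pwDl// sqr_ge0.
have aw : cabs w = cre w * Num.sqrt (1 + t ^+ 2).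
  rewrite cabsE -[X in X * _](gtr0_norm w0) -sqrtr_sqr -sqrtrM ?sqr_ge0//.
  by congr Num.sqrt; rewrite /t; field; rewrite gt_eqF.
have ct : cos (atan t) = (Num.sqrt (1 + t ^+ 2))^-1 by rewrite cos_atan.
have st : sin (atan t) = t * cos (atan t).
  rewrite -{2}(atanK t) /tan divfK// ct.
  by rewrite invr_neq0// gt_eqF.
apply: eq_creim => /=; rewrite -/t lnK ?posrE ?cabs_gt0// ?st ct aw.
  by field; rewrite gt_eqF.
rewrite /t; field; rewrite gt_eqF//=; exact: lt0r_neq0.
Qed.

Lemma cim_clog w : `|cim (clog w)| < pi / 2.
Proof. by rewrite /= ltr_norml atan_gtNpi2 atan_ltpi2. Qed.

Lemma cexpK z : `|cim z| < pi / 2 -> clog (cexp z) = z.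
Proof.
move=> zp; apply: cexp_inj.
  have := cim_clog (cexp z); move: zp; rewrite !ltr_norml; lra.
apply: clogK => /=; rewrite mulr_gt0 ?expR_gt0// cos_gt0_pihalf//.
by rewrite -ltr_norml.
Qed.

Lemma clog_continuous w : 0 < cre w -> {for w, continuous clog}.
Proof.
move=> w0; have wn : w != 0 by apply: contraTneq w0 => ->; rewrite ltxx.
apply: (@continuous_mkC R _ (fun w => ln (cabs w)) (fun w => atan (cim w / cre w))).
  apply: (@continuous_comp _ _ _ (@cabs R) (@ln R)); first exact: continuous_cabs.
  exact/continuous_ln/cabs_gt0.
apply: (@continuous_comp _ _ _ (fun w => cim w / cre w) (@atan R));
  last exact: continuous_atan.
apply: continuousM; first exact: continuous_cim.
apply: continuousV; [by rewrite gt_eqF|exact: continuous_cre].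
Qed.

(** Multiplication by one of 1, -1, i, -i, each a value of [cexp], brings [a] into the right
    half-plane, where [clog] inverts. *)
Lemma cexp_surj a : a != 0 -> exists z, cexp z = a.
Proof.
move=> a0.
have H c u : cexp c = u -> 0 < cre (u * a) -> exists z, cexp z = a.
  move=> cu /clogK E; exists (clog (u * a) - c).
  by rewrite cexpB E cu mulrAC divff ?mul1r// -cu cexp_neq0.
have [r|r|r] := ltgtP (cre a) 0.
- by apply: H cexp_pi _; rewrite mulN1r creN oppr_gt0.
- by apply: H cexp0 _; rewrite mul1r.
have [i|i|i] := ltgtP (cim a) 0.
- by apply: H cexp_pihalf _; rewrite creM /= mul0r mul1r sub0r oppr_gt0.
- apply: (H (- mkC 0 (pi / 2)) (- mkC 0 1)).
    rewrite cexpN cexp_pihalf; apply: (mulfI (_ : mkC 0 1 != 0 :> CC R)).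
      by rewrite -cexp_pihalf cexp_neq0.
    rewrite mulfV -?cexp_pihalf ?cexp_neq0// cexp_pihalf.
    by apply: eq_creim; rewrite ?creM ?cimM /=; ring.
  by rewrite mulNr creN creM /= mul0r mul1r sub0r opprK.
by case/eqP: a0; apply: eq_creim.
Qed.

(** This second-order bound makes [cexp] its own derivative. With [a], [b] the coordinates of [h],
    the two parts contribute at most [2a^2 + 2b^2] and [2b^2 + 2|a||b| <= a^2 + 3b^2], so 6
    suffices. *)
Lemma cexpB1Bid_le h : cabs h <= 2^-1 ->
  cabs (cexp h - 1 - h) <= 6 * cabs h ^+ 2.
Proof.
move=> h2; set a := cre h; set b := cim h.
have a2 : `|a| <= 2^-1 by exact: le_trans (cre_le _) h2.
have b2 : `|b| <= 2^-1 by exact: le_trans (cim_le _) h2.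
apply: le_trans (cabs_le _) _; rewrite !creD !cimD !creN !cimN cabs_sqr -/a -/b /=.
rewrite oppr0 addr0 -/a -/b.
have A := expRB1Bid_le a2; have B := cosB1_le b.
have b1 : `|b| <= 1 by lra.
have C := sinBid_le b1.
have e0 := expR_gt0 a.
have nb := normr_ge0 b; have na := normr_ge0 a.
have sa : `|a| ^+ 2 = a ^+ 2 by rewrite real_normK ?num_real.
have sb : `|b| ^+ 2 = b ^+ 2 by rewrite real_normK ?num_real.
have a2sq : a ^+ 2 <= `|a| / 2 by rewrite -sa; nra.
have e1 : `|expR a - 1| <= 2 * `|a|.
  have -> : expR a - 1 = (expR a - 1 - a) + a by ring.
  apply: le_trans (ler_normD _ _) _; lra.
have e2 : expR a <= 2 by have := ler_norm (expR a - 1); lra.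
have E1 : `|expR a * cos b - 1 - a| <= 2 * a ^+ 2 + 2 * b ^+ 2.
  have -> : expR a * cos b - 1 - a = (expR a - 1 - a) + expR a * (cos b - 1) by ring.
  apply: le_trans (ler_normD _ _) _; apply: lerD => //.
  rewrite normrM gtr0_norm//; apply: ler_pM => //; exact: ltW.
have E2 : `|expR a * sin b - b| <= 2 * b ^+ 2 + 2 * `|a| * `|b|.
  have -> : expR a * sin b - b = expR a * (sin b - b) + (expR a - 1) * b by ring.
  apply: le_trans (ler_normD _ _) _; rewrite !normrM gtr0_norm//; apply: lerD.
    by apply: ler_pM => //; exact: ltW.
  exact: ler_wpM2r.
have : 2 * `|a| * `|b| <= a ^+ 2 + b ^+ 2.
  by rewrite -sa -sb; have := sqr_ge0 (`|a| - `|b|); nra.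
have := sqr_ge0 a; have := sqr_ge0 b; lra.
Qed.

Lemma is_derive_cexp z : is_derive z (1 : CC R) cexp (cexp z).
Proof.
have H : (fun h : CC R => h^-1 *: ((cexp \o shift z) (h *: 1) - cexp z)) @ 0^'
    --> cexp z.
  move=> A /nbhs_cabsP[e e0 HA].
  set M := cabs (cexp z); have M0 : 0 < M by rewrite cabs_gt0// cexp_neq0.
  (* Within [1/2] the second-order bound applies; the other radius makes the resulting error
     [6 * M * cabs h] less than [e]. *)
  apply/nbhs_cabsP; exists (Num.min 2^-1 (e / (6 * M))).
    by rewrite lt_min invr_gt0 ltr0n divr_gt0// mulr_gt0.
  move=> h; rewrite subr0 lt_min => /andP[h2 he] h0; apply: HA.
  have -> : h^-1 *: ((cexp \o shift z) (h *: 1) - cexp z) - cexp z =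
      cexp z * (cexp h - 1 - h) / h.
    rewrite /= [h *: 1]mulr1 cexpD.
    change (h^-1 * (cexp h * cexp z - cexp z) - cexp z = cexp z * (cexp h - 1 - h) / h).
    by field.
  rewrite !cabsM -/M cabsV.
  have h0' := cabs_gt0 h0.
  rewrite ltr_pdivrMr// (le_lt_trans (ler_wpM2l (ltW M0) (cexpB1Bid_le (ltW h2))))//.
  move: he; rewrite ltr_pdivlMr ?mulr_gt0// => he.
  by nra.
by apply: DeriveDef; [apply/cvg_ex; exists (cexp z)|exact: cvg_lim].
Qed.

(** The differential is linear over [CC R], so its value at [df] is [df] times its value at 1. *)
Lemma is_derive_compC (f g : CC R -> CC R) z df dg :
  is_derive z (1 : CC R) f df -> is_derive (f z) (1 : CC R) g dg ->
  is_derive z (1 : CC R) (g \o f) (dg * df).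
Proof.
move=> [/derivable1_diffP Df Ef] [/derivable1_diffP Dg Eg].
have Dgf := differentiable_comp Df Dg.
apply: DeriveDef; first exact/derivable1_diffP.
apply: etrans (deriveE _ Dgf) _.
apply: etrans (congr1 (fun u => u 1) (diff_comp Df Dg)) _.
have Ed : 'd f z 1 = df *: (1 : CC R) by rewrite -(deriveE _ Df) Ef; apply/esym/mulr1.
apply: etrans (congr1 ('d g (f z)) Ed) _.
apply: etrans (linearZ_LR _ _ _) _.
apply: etrans (congr1 ( *:%R df) (etrans (esym (deriveE _ Dg)) Eg)) _.
exact: mulrC.
Qed.

End complex_exponential.

(** * Local homeomorphisms of the plane *)

Section local_homeomorphisms.
Variable R : realType.
Implicit Types (f g : CC R -> CC R) (z w c : CC R).

Definition loc_homeo f := [/\ continuous f, forall z, noncritical f z &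
  forall z A, nbhs z A -> nbhs (f z) (f @` A)].

Lemma loc_homeo_comp f g : loc_homeo f -> loc_homeo g -> loc_homeo (g \o f).
Proof.
move=> [cf lf of_] [cg lg og]; split.
- by move=> z; apply: continuous_comp; [exact: cf|exact: cg].
- move=> z; have [U [zU Ui]] := lf z; have [V [fV Vi]] := lg (f z).
  exists (U `&` f @^-1` V); split; first exact: filterI zU (cf z V fV).
  by move=> x y [Ux Vx] [Uy Vy] /= /(Vi _ _ Vx Vy); exact: Ui.
- by move=> z A /of_/og; rewrite image_comp.
Qed.

(** A local right inverse [s] gives openness: near [f z], every [w] with [s w] in [A] is the image
    of [s w]. *)
Lemma loc_homeo_section f : continuous f -> (forall z, noncritical f z) ->
  (forall z, exists s : CC R -> CC R, [/\ {for f z, continuous s}, s (f z) = z &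
    nbhs (f z) [set w | f (s w) = w]]) -> loc_homeo f.
Proof.
move=> cf lf H; split; [exact: cf|exact: lf|move=> z A zA]; have [s [cs sz fs]] := H z.
have : nbhs (f z) (s @^-1` A) by apply: cs; rewrite sz.
by move/filterI => /(_ _ fs); apply: filterS => w [Aw Ew]; exists (s w).
Qed.

Lemma cmul_continuous c : continuous (fun z => c * z).
Proof. by move=> z; apply: continuousM; [exact: cst_continuous|exact: cvg_id]. Qed.

Lemma caffine_continuous c d : continuous (fun z => c * z + d : CC R).
Proof. by move=> z; apply: continuousD; [exact: cmul_continuous|exact: cst_continuous]. Qed.

Lemma loc_homeo_affine c d : c != 0 -> loc_homeo (fun z => c * z + d).
Proof.
move=> c0; apply: loc_homeo_section; first exact: caffine_continuous.
  move=> z; exists setT; split; first exact: filterT.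
  by move=> x y _ _ /addIr/(mulfI c0).
move=> z; exists (fun w => c^-1 * w + - (c^-1 * d)); split.
- exact: caffine_continuous.
- by rewrite mulrDr mulKf// addrK.
- by apply: filterS (@filterT _ _ _) => w _ /=; rewrite mulrDr mulrN !mulVKf// subrK.
Qed.

(** The principal logarithm recentred: division by [cexp z] moves the base value to 1, and adding
    [z] restores the chosen preimage. *)
Lemma cexp_section z : exists s : CC R -> CC R,
  [/\ forall w, 0 < cre (w / cexp z) -> {for w, continuous s}, s (cexp z) = z &
      forall w, 0 < cre (w / cexp z) -> cexp (s w) = w].
Proof.
exists (fun w => clog (w / cexp z) + z); split.
- move=> w wz; apply: continuousD; last exact: cst_continuous.
  apply: (@continuous_comp _ _ _ (fun w => w / cexp z) (@clog R));
    last exact: clog_continuous.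
  by apply: continuousM; [exact: cvg_id|exact: cst_continuous].
- rewrite divff ?cexp_neq0// -[X in clog X]cexp0 cexpK ?add0r//=.
  by rewrite normr0 divr_gt0// pi_gt0.
- by move=> w wz; rewrite cexpD clogK// divfK// cexp_neq0.
Qed.

Lemma open_cre_gt0 c : open [set w : CC R | 0 < cre (w / c)].
Proof.
have -> : [set w : CC R | 0 < cre (w / c)] =
   (fun w => cre (w / c)) @^-1` [set x : R | 0 < x] by [].
apply: open_comp; last exact: open_gt.
move=> w _; apply: (@continuous_comp _ _ _ (fun w => w / c) (@cre R));
  last exact: continuous_cre.
by apply: continuousM; [exact: cvg_id|exact: cst_continuous].
Qed.

Lemma loc_homeo_cexp : loc_homeo (@cexp R).
Proof.
apply: loc_homeo_section; first exact: continuous_cexp.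
  (* Two points of this square have imaginary parts at most 1 apart, which is less than [pi]. *)
  move=> z; exists (csquare z 2^-1); split; first exact: nbhs_csquare.
  move=> x y [_ xz] [_ yz]; apply: cexp_inj.
  have := pi_ge2 R; move: xz yz; rewrite !ler_norml ltr_norml; lra.
move=> z; have [s [cs sz fs]] := cexp_section z.
have z0 : 0 < cre (cexp z / cexp z) by rewrite divff ?cexp_neq0//= ltr01.
exists s; split => //; first exact: cs.
have N : nbhs (cexp z) [set w | 0 < cre (w / cexp z)].
  by apply: open_nbhs_nbhs; split => //; exact: open_cre_gt0.
by apply: filterS N => w; exact: fs.
Qed.

Lemma loc_homeo_pointed f : loc_homeo f -> pointed_surface (plane_triple f).
Proof.
move=> [cf lf of_].
have cSf : continuous (fun z => Some (f z) : Chat R).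
  by move=> z; apply: (continuous_comp (cf z));
    exact: one_point_compactification_some_continuous.
split; last first.
  have [U [U0 Ui]] := lf 0; exists U; split => // x y Ux Uy /= [] ; exact: Ui.
split => //=; first exact: CC_open_surface.
  move=> A oA; have -> : (fun z => Some (f z) : Chat R) @` A = Some @` (f @` A).
    by rewrite image_comp.
  apply: one_point_compactification_open_some.
  rewrite openE => _ [z Az <-]; apply: of_; exact: open_nbhs_nbhs.
move=> z; have [U [Uz Ui]] := lf z; exists U; split => // y Uy /= [] E.
exact: Ui (nbhs_singleton Uz) E.
Qed.

End local_homeomorphisms.

(** * Growth order *)

Section growth.
Variable R : realType.
Implicit Types (f g : CC R -> CC R) (z w c : CC R).

Lemma max_modulusE f (M r : R) : 0 <= r ->
  (forall z, cabs z = r -> cabs (f z) <= M) -> cabs (f (mkC r 0)) = M ->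
  max_modulus f r = M.
Proof.
move=> r0 H E; have ar : cabs (mkC r 0) = r.
  by rewrite cabsE /= expr0n addr0 sqrtr_sqr ger0_norm.
have MA : [set cabs (f z) | z in [set z : CC R | cabs z = r]] M by exists (mkC r 0).
have ub : ubound [set cabs (f z) | z in [set z : CC R | cabs z = r]] M.
  by move=> _ [z /= zr <-]; exact: H.
apply/eqP; rewrite eq_le; apply/andP; split.
  by apply: ge_sup => //; exists M.
by apply: ub_le_sup => //; exists M.
Qed.

Lemma pinfty_set (V : set R) (M : R) : pinfty_nbhs R V -> exists2 r, M < r & V r.
Proof.
move=> [A [_ AV]]; exists (Num.max A M + 1).
  by rewrite (@le_lt_trans _ _ (Num.max A M)) ?le_max ?lexx ?orbT// ltrDl.
by apply: AV; rewrite (@le_lt_trans _ _ (Num.max A M)) ?le_max ?lexx// ltrDl.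
Qed.

(** For [r > 1] the quotient is [1 + ln 2 / ln r]: at least 1, and within [e] of it once
    [r > expR (ln 2 / e)]. *)
Lemma entire_order_eq1 f : (forall r, 0 <= r -> max_modulus f r = expR (2 * r)) ->
  entire_order f = 1%E.
Proof.
move=> Hf; rewrite /entire_order limf_esupE.
have E (r : R) : 1 < r -> ln (ln (max_modulus f r)) / ln r = 1 + ln 2 / ln r.
  move=> r1; rewrite Hf ?expRK; last lra.
  rewrite lnM ?posrE//; last lra.
  by rewrite mulrDl divff 1?addrC// gt_eqF// ln_gt0.
apply/eqP; rewrite eq_le; apply/andP; split.
  apply/lee_addgt0Pr => e e0.
  have l2 : 0 < ln (2 : R) by rewrite ln_gt0// ltr1n.
  apply: ge_ereal_inf; exists (ereal_sup [set (ln (ln (max_modulus f r)) / ln r)%:E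
      | r in [set r | expR (ln 2 / e) < r]]).
    exists [set r | expR (ln 2 / e) < r] => //.
    by exists (expR (ln 2 / e)); split; [exact: num_real|].
  apply: ge_ereal_sup => _ [r /= er <-].
  have r1 : 1 < r by apply: le_lt_trans _ er; rewrite -[leLHS]expR0 ler_expR divr_ge0// ltW.
  rewrite E// -EFinD lee_fin lerD2l ler_pdivrMr ?ln_gt0//.
  rewrite mulrC -ler_pdivrMr// -[leLHS]expRK ler_ln ?posrE ?expR_gt0 ?ltW//; lra.
apply: le_ereal_inf_tmp => _ [V VF <-].
have [r r1 Vr] := pinfty_set 1 VF.
apply: le_ereal_sup_tmp; exists (ln (ln (max_modulus f r)) / ln r)%:E; first by exists r.
by rewrite E// lee_fin lerDl divr_ge0// ln_ge0// ?ler1n// ltW.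
Qed.

(** Once [expR (r / m) >= 2], the logarithm of the maximum modulus is at least [expR (r / m)], so
    its own logarithm is at least [r / m], which outgrows every multiple of [ln r]. *)
Lemma entire_order_pinfty f (m : R) : 1 <= m ->
  (forall r, 0 <= r -> max_modulus f r = expR (2 * (m * (expR (r / m) - 1)))) ->
  entire_order f = +oo%E.
Proof.
move=> m1 Hf; rewrite /entire_order limf_esupE.
have m0 : 0 < m by lra.
apply/eqP; rewrite eq_le leey/=; apply: le_ereal_inf_tmp => _ [V VF <-].
rewrite leye_eq; apply/eqP/eq_infty => A.
set B := Num.max A 1; have AB : A <= B by rewrite le_max lexx.
have B1 : 1 <= B by rewrite le_max lexx orbT.
(* Beyond the square, [q], the root of [r], exceeds [2 * (B * m)], and [ln r = 2 ln q < 2q] yields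
   [B * ln r <= r / m]. Beyond 1 and [m], [ln r] is positive and [expR (r / m) >= 2]. *)
have [r rM Vr] := pinfty_set (Num.max ((2 * (B * m)) ^+ 2) (Num.max 1 m)) VF.
move: rM; rewrite !gt_max => /and3P[rB r1 rm].
apply: le_ereal_sup_tmp; exists (ln (ln (max_modulus f r)) / ln r)%:E; first by exists r.
have r0 : 0 < r by lra.
rewrite lee_fin Hf ?expRK; last lra.
rewrite (le_trans AB)// ler_pdivlMr ?ln_gt0//.
have e2 : 2 <= expR (r / m).
  apply: le_trans (expR_ge1Dx _); have : 1 <= r / m by rewrite ler_pdivlMr// mul1r ltW.
  lra.
apply: (@le_trans _ _ (r / m)); last first.
  by rewrite -[leLHS]expRK ler_ln ?posrE ?expR_gt0//; nra.
set q := Num.sqrt r; have q0 : 0 < q by rewrite sqrtr_gt0.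
have rq : r = q ^+ 2 by rewrite sqr_sqrtr// ltW.
have qB : 2 * (B * m) < q.
  by rewrite -(@ltr_pXn2r _ 2) ?nnegrE ?ltW// -?rq//; nra.
rewrite ler_pdivlMr// {1}rq lnXn// rq mulr2n.
have := ln_sublinear q0; have : 0 < B * m by nra.
by nra.
Qed.

End growth.

(** * The approximating functions *)

Section example.
Variable R : realType.
Implicit Types (z w c : CC R) (n : nat).

Definition fexp z : CC R := cexp (2 * z).
Definition gexp n z : CC R := n.+1%:R * (cexp (z / n.+1%:R) - 1).
Definition fgexp n z : CC R := fexp (gexp n z).
Definition ginv n w : CC R := n.+1%:R * clog (1 + w / n.+1%:R).

Lemma natC_neq0 n : n.+1%:R != 0 :> CC R.
Proof. by rewrite pnatr_eq0. Qed.

Lemma creM_nat n z : cre (n%:R * z) = n%:R * cre z.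
Proof. by rewrite !mulr_natl; elim: n => [//|n IH]; rewrite !mulrSr creD IH. Qed.

Lemma cimM_nat n z : cim (n%:R * z) = n%:R * cim z.
Proof. by rewrite !mulr_natl; elim: n => [//|n IH]; rewrite !mulrSr cimD IH. Qed.

Lemma cre_div_nat n z : cre (z / n.+1%:R) = cre z / n.+1%:R.
Proof.
have n0 : n.+1%:R != 0 :> R by rewrite pnatr_eq0.
apply: (mulIf n0); rewrite divfK// mulrC -creM_nat; congr cre.
by rewrite mulrC divfK ?natC_neq0.
Qed.

Lemma cim_div_nat n z : cim (z / n.+1%:R) = cim z / n.+1%:R.
Proof.
have n0 : n.+1%:R != 0 :> R by rewrite pnatr_eq0.
apply: (mulIf n0); rewrite divfK// mulrC -cimM_nat; congr cim.
by rewrite mulrC divfK ?natC_neq0.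
Qed.

Lemma is_derive_affine c (d : CC R) z : is_derive z (1 : CC R) (fun z => c * z + d) c.
Proof.
have H := is_deriveD (is_deriveZ c (is_derive_id z (1 : CC R))) (is_derive_cst d z (1 : CC R)).
by apply: is_derive_eq H _; rewrite addr0; exact: mulr1.
Qed.

Lemma fexpE : fexp = @cexp R \o (fun z => 2 * z + 0).
Proof. by apply/funext => z /=; rewrite addr0. Qed.

(** Affine maps alternating with [cexp]: the form to which the chain rule and [loc_homeo_comp]
    apply. *)
Lemma fgexpE n : fgexp n = @cexp R \o (fun z => (2 * n.+1%:R) * z + - (2 * n.+1%:R)) \o
  (@cexp R \o (fun z => n.+1%:R^-1 * z + 0)).
Proof.
apply/funext => z; rewrite /fgexp /fexp /gexp /= addr0 mulrA mulrBr mulr1.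
by rewrite [z / _]mulrC.
Qed.

Lemma is_derive_fexp z : is_derive z (1 : CC R) fexp (fexp z * 2).
Proof.
rewrite fexpE; apply: is_derive_compC (is_derive_affine _ _ _) _.
exact: is_derive_cexp.
Qed.

Lemma is_derive_fgexp n z :
  is_derive z (1 : CC R) (fgexp n) (fgexp n z * (2 * cexp (z / n.+1%:R))).
Proof.
rewrite fgexpE.
have H1 := is_derive_compC (is_derive_affine n.+1%:R^-1 0 z) (is_derive_cexp _).
have H2 := is_derive_compC (is_derive_affine (2 * n.+1%:R) (- (2 * n.+1%:R))
  ((@cexp R \o (fun z => n.+1%:R^-1 * z + 0)) z)) (is_derive_cexp _).
apply: is_derive_eq (is_derive_compC H1 H2) _.
rewrite /= addr0 [z / _]mulrC; set u := cexp (n.+1%:R^-1 * z).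
rewrite -!mulrA; congr (_ * (_ * _)).
by rewrite mulrCA mulfV ?natC_neq0// mulr1.
Qed.

Lemma loc_homeo_fexp : loc_homeo fexp.
Proof.
rewrite fexpE; apply: loc_homeo_comp (loc_homeo_cexp _).
by apply: loc_homeo_affine; rewrite pnatr_eq0.
Qed.

Lemma loc_homeo_fgexp n : loc_homeo (fgexp n).
Proof.
rewrite fgexpE; apply: loc_homeo_comp.
  apply: loc_homeo_comp (loc_homeo_cexp _).
  by apply: loc_homeo_affine; rewrite invr_eq0 natC_neq0.
apply: loc_homeo_comp (loc_homeo_cexp _).
by apply: loc_homeo_affine; rewrite mulf_neq0// ?natC_neq0// pnatr_eq0.
Qed.

Lemma gexp0 n : gexp n 0 = 0.
Proof. by rewrite /gexp mul0r cexp0 subrr mulr0. Qed.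

Lemma fexp0 : fexp 0 = 1. Proof. by rewrite /fexp mulr0 cexp0. Qed.

Lemma fgexp0 n : fgexp n 0 = 1. Proof. by rewrite /fgexp gexp0 fexp0. Qed.

(** The spherical derivative is [2 / (1 + 1)]; this is why the exponent of [fexp] carries a factor
    2. *)
Lemma normalized_of (f : CC R -> CC R) : loc_homeo f -> f 0 = 1 ->
  is_derive (0 : CC R) (1 : CC R) f 2 -> normalized_plane f.
Proof.
move=> lf f0 [_ df]; split; first exact: loc_homeo_pointed.
rewrite /sph_deriv df f0 normr1 expr1n -[1 + 1]/(2 : CC R) divff// pnatr_eq0.
Qed.

Lemma normalized_fexp : normalized_plane fexp.
Proof.
apply: normalized_of (loc_homeo_fexp) fexp0 _.
by apply: is_derive_eq (is_derive_fexp 0) _; rewrite fexp0 mul1r.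
Qed.

Lemma normalized_fgexp n : normalized_plane (fgexp n).
Proof.
apply: normalized_of (loc_homeo_fgexp n) (fgexp0 n) _.
by apply: is_derive_eq (is_derive_fgexp n 0) _; rewrite fgexp0 mul0r cexp0 mul1r mulr1.
Qed.

Lemma order_fexp : entire_order fexp = 1%E.
Proof.
apply: entire_order_eq1 => r r0; apply: max_modulusE => // [z <-|].
  rewrite cabs_cexp creM_nat ler_expR ler_pM2l//.
  exact: le_trans (ler_norm _) (cre_le _).
by rewrite cabs_cexp creM_nat.
Qed.

(** On a circle the modulus is largest at the positive real point, since [cos] is at most 1 and
    [cre z] at most [cabs z]. *)
Lemma order_fgexp n : entire_order (fgexp n) = +oo%E.
Proof.
have E z : cabs (fgexp n z) = expR (2 * (n.+1%:R *
    (expR (cre z / n.+1%:R) * cos (cim z / n.+1%:R) - 1))).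
  rewrite cabs_cexp 2!creM_nat creD creN.
  by rewrite -cre_div_nat -cim_div_nat.
apply: (@entire_order_pinfty _ _ n.+1%:R); first by rewrite ler1n.
move=> r r0; apply: max_modulusE => // [z zr|]; last by rewrite E /= mul0r cos0 mulr1.
rewrite E ler_expR ler_pM2l// ler_pM2l ?ltr0n// lerD2r.
apply: le_trans (ler_wpM2l (expR_ge0 _) (cos_le1 _)) _.
rewrite mulr1 ler_expR ler_pM2r ?invr_gt0 ?ltr0n// -zr.
exact: le_trans (ler_norm _) (cre_le _).
Qed.

Lemma ginvK n w : - n.+1%:R < cre w -> gexp n (ginv n w) = w.
Proof.
move=> wn; rewrite /gexp /ginv [_ * clog _]mulrC mulfK ?natC_neq0// clogK.
  by rewrite [1 + _]addrC addrK mulrC divfK// natC_neq0.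
rewrite creD cre_div_nat /= -ltrBlDl sub0r ltr_pdivlMr ?ltr0n//.
by rewrite mulN1r.
Qed.

Lemma ginv_continuous n w : - n.+1%:R < cre w -> {for w, continuous (ginv n)}.
Proof.
move=> wn; apply: continuousM; first exact: cst_continuous.
apply: (@continuous_comp _ _ _ (fun w : CC R => 1 + w / n.+1%:R) (@clog R)).
  apply: continuousD; first exact: cst_continuous.
  by apply: continuousM; [exact: cvg_id|exact: cst_continuous].
apply: clog_continuous; rewrite creD cre_div_nat /= -ltrBlDl sub0r ltr_pdivlMr ?ltr0n//.
by rewrite mulN1r.
Qed.

(** In this strip [z / n.+1%:R] has imaginary part below [pi / 2] in absolute value, where [clog] is
    a left inverse of [cexp]. *)
Lemma gexpK n z : `|cim z| < n.+1%:R * (pi / 2) -> ginv n (gexp n z) = z.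
Proof.
move=> zn; rewrite /ginv /gexp [_ * (_ - 1)]mulrC mulfK ?natC_neq0//.
rewrite [1 + _]addrC subrK cexpK; first by rewrite mulrC divfK// natC_neq0.
by rewrite cim_div_nat normrM normfV normr_nat ltr_pdivrMr ?ltr0n// mulrC.
Qed.

Lemma gexp_continuous n : continuous (gexp n).
Proof.
move=> z.
change {for z, continuous (fun z : CC R => n.+1%:R * (cexp (z / n.+1%:R) - 1))}.
apply: continuousM; first exact: cst_continuous.
apply: continuousD; last exact: cst_continuous.
apply: (@continuous_comp _ _ _ (fun w : CC R => w / n.+1%:R) (@cexp R));
  last exact: continuous_cexp.
by apply: continuousM; [exact: cvg_id|exact: cst_continuous].
Qed.

Lemma ginv0 n : ginv n 0 = 0.
Proof.
rewrite -[X in ginv n X](gexp0 n) gexpK//= normr0 mulr_gt0 ?ltr0n// divr_gt0//.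
exact: pi_gt0.
Qed.

(** * The first kernel condition and the standing assumption *)

Lemma increasing_ge (sigma : nat -> nat) :
  (forall k, (sigma k < sigma k.+1)%N) -> forall k, (k <= sigma k)%N.
Proof. by move=> H; elim=> // k IH; exact: leq_ltn_trans IH (H k). Qed.

(** The exceptional set is empty. A bound [M] for [K] serves as threshold because [sigma n >= n],
    and [gexp] inverts the embedding [ginv]. *)
Lemma kernel_cond1_fexp (sigma : nat -> nat) :
  (forall k, (sigma k < sigma k.+1)%N) ->
  kernel_cond1 (fun k => plane_triple (fgexp (sigma k))) (plane_triple fexp).
Proof.
move=> /increasing_ge Hs; exists set0; split => //.
  by move=> z; exists setT; split => //; exact: filterT.
move=> K cK _ _; have [M HM] := compact_cabs_bounded cK.
exists M => n Mn.
have HK w : K w -> - (sigma n).+1%:R < cre w.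
  move=> /HM wM; have := le_lt_trans (cre_le w) wM.
  rewrite ltr_norml => /andP[wM' _]; apply: lt_trans wM'.
  by rewrite ltrN2 ltr_nat ltnS (leq_trans (ltnW Mn)).
exists (ginv (sigma n)); split; [|exact: ginv0|].
  split.
  - apply: continuous_in_subspaceT => w; rewrite inE => Kw.
    exact/ginv_continuous/HK.
  - by move=> x y /HK Kx /HK Ky E; rewrite -(ginvK Kx) E ginvK.
  - exists (gexp (sigma n)); split; last by move=> x /HK; exact: ginvK.
    by apply: continuous_subspaceT; exact: gexp_continuous.
by move=> x /HK Kx /=; rewrite /fgexp ginvK.
Qed.

(* The chordal ball of radius 1/4 about 1, in real coordinates and without square roots *)
Let ball1 : set (CC R) := [set w |
  32 * ((1 - cre w) * (1 - cre w) + cim w * cim w) <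
    1 + cre w * cre w + cim w * cim w].

Lemma sph_ball1 (q : Chat R) :
  sph_ball (Some 1 : Chat R) (1 / 4) q <-> exists2 w, ball1 w & q = Some w.
Proof.
have s1 : cabs (1 : CC R) = 1 by exact: ComplexField.Normc.normc1.
case: q => [w|]; last first.
  split; last by case.
  change (2 / Num.sqrt (1 + cabs (1 : CC R) ^+ 2) < 1 / 4 -> exists2 w, ball1 w & None = Some w).
  rewrite s1 expr1n ltr_pdivrMr ?sqrtr_gt0//.
  have s2 : Num.sqrt (1 + 1 : R) <= 2.
    rewrite -(@ler_pXn2r _ 2)// ?nnegrE ?sqrtr_ge0// sqr_sqrtr//; lra.
  by move=> H; exfalso; lra.
suff E : 2 * cabs (1 - w) / Num.sqrt ((1 + cabs 1 ^+ 2) * (1 + cabs w ^+ 2)) < 1 / 4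
    <-> ball1 w.
  split; first by exists w => //; exact/E.
  by move=> [v Bv [wv]]; apply/E; rewrite wv.
have P : 0 < (1 + cabs (1 : CC R) ^+ 2) * (1 + cabs w ^+ 2).
  by rewrite s1 expr1n mulr_gt0// ltr_pwDl// sqr_ge0.
rewrite ltr_pdivrMr ?sqrtr_gt0// -(@ltr_pXn2r _ 2) ?nnegrE ?mulr_ge0 ?cabs_ge0 ?sqrtr_ge0//.
rewrite !exprMn sqr_sqrtr ?ltW// s1 !cabs_sqr creD cimD creN cimN /= /ball1 /=.
by split; lra.
Qed.

(** Keeps the ball inside the half-plane where [clog] is a continuous logarithm. *)
Lemma ball1_cre w : ball1 w -> 1 / 2 < cre w.
Proof. by rewrite /ball1 /= => H; nra. Qed.

Lemma connected_ball1 : connected ball1.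
Proof.
apply: (@star_connected _ 1); first by rewrite /ball1 /=; lra.
move=> w t; rewrite /ball1 /= => H /andP[t0 t1].
set a := cre w in H *; set b := cim w in H *.
(* In terms of [s], membership in the ball reads [31 * s < 2 + 2 * (a - 1)]. Moving to parameter [t]
   replaces [s] by [t^2 s], at most [t * s], and [a - 1] by [t * (a - 1)]. *)
set s := (a - 1) * (a - 1) + b * b.
have s0 : 0 <= s by rewrite addr_ge0// -expr2 sqr_ge0.
have Hs : 31 * s < 2 + 2 * (a - 1) by rewrite /s; lra.
have ts : t * (t * s) <= t * s by apply: ler_piMl => //; exact: mulr_ge0.
suff : 31 * (t * (t * s)) < 2 + 2 * (t * (a - 1)) by rewrite /s; lra.
have [->|tn] := eqVneq t 0; first by rewrite !mul0r; lra.
have tp : 0 < t by rewrite lt_neqAle eq_sym tn.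
have : t * (31 * s) < t * (2 + 2 * (a - 1)) by rewrite ltr_pM2l.
lra.
Qed.

Lemma open_ball1 : open ball1.
Proof.
pose F (w : CC R) : R := 1 + cre w * cre w + cim w * cim w -
  32 * ((1 - cre w) * (1 - cre w) + cim w * cim w).
have -> : ball1 = F @^-1` [set x | 0 < x].
  by apply/seteqP; split=> w; rewrite /ball1 /F /= subr_gt0.
apply: open_comp; last exact: open_gt.
move=> w _; have cr := @continuous_cre R w; have ci := @continuous_cim R w.
have c1 : {for w, continuous (fun _ : CC R => 1 : R)} by exact: cst_continuous.
have c32 : {for w, continuous (fun _ : CC R => 32 : R)} by exact: cst_continuous.
have ii := continuousM ci ci.
have d := continuousB c1 cr.
exact: (continuousB (continuousD (continuousD c1 (continuousM cr cr)) ii)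
  (continuousM c32 (continuousD (continuousM d d) ii))).
Qed.

(** The branch of the inverse of [fgexp n] that sends 1 to 0; its image of the ball is the domain
    required by the standing assumption. *)
Let section1 n w := ginv n (clog w / 2).

(** On the ball [cabs w > 1/2], so half the logarithm has real part above -1, whatever [n] is. *)
Lemma cre_half_log n w : ball1 w -> - n.+1%:R < cre (clog w / 2).
Proof.
move=> /ball1_cre w2; rewrite cre_div_nat ltr_pdivlMr//=.
have wa : 1 / 2 < cabs w.
  by apply: lt_le_trans w2 _; apply: le_trans (ler_norm _) (cre_le _).
have n1 : 1 <= n.+1%:R :> R by rewrite ler1n.
have l : ln (1 / 2) <= ln (cabs w) by rewrite ler_ln ?posrE ?ltW//; lra.
have : ln (2 : R) < 2 by apply: ln_sublinear.
move: l; rewrite ln_div ?posrE// ln1; lra.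
Qed.

Lemma section1_continuous n w : ball1 w -> {for w, continuous (section1 n)}.
Proof.
move=> Bw.
apply: (@continuous_comp _ _ _ (fun w : CC R => clog w / 2) (ginv n)).
  apply: continuousM; last exact: cst_continuous.
  apply: clog_continuous; have := ball1_cre Bw; lra.
exact/ginv_continuous/cre_half_log.
Qed.

Lemma section1K n w : ball1 w -> fgexp n (section1 n w) = w.
Proof.
move=> Bw; rewrite /fgexp ginvK; last exact: cre_half_log.
rewrite /fexp mulrC divfK ?pnatr_eq0// clogK//; have := ball1_cre Bw; lra.
Qed.

(** Describes the image by open conditions: the strip lets [ginv] undo [gexp], and the bound
    [pi / 4] lets [clog] undo [cexp] after doubling. *)
Lemma section1_imageE n : section1 n @` ball1 =
  [set z | `|cim z| < n.+1%:R * (pi / 2)] `&`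
  ([set z | `|cim (gexp n z)| < pi / 4] `&` fgexp n @^-1` ball1).
Proof.
apply/seteqP; split=> [_ [w Bw <-]|z [z1 [z2 z3]]].
  split; last split.
  - rewrite /= /section1 /ginv cimM_nat normrM normr_nat ltr_pM2l ?ltr0n//.
    exact: cim_clog.
  - rewrite /= ginvK; last exact: cre_half_log.
    rewrite cim_div_nat normrM normfV normr_nat ltr_pdivrMr//.
    by have := cim_clog w; lra.
  - by rewrite /preimage /= section1K.
exists (fgexp n z) => //; rewrite /section1 /fgexp /fexp cexpK.
  by rewrite mulrC mulKf ?pnatr_eq0// gexpK.
rewrite cimM_nat normrM normr_nat; move: z2 => /=; lra.
Qed.

Lemma open_section1_image n : open (section1 n @` ball1).
Proof.
rewrite section1_imageE; apply: openI; last apply: openI.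
- apply: (@open_comp _ _ (fun z : CC R => `|cim z|) [set x : R | x < _]); last exact: open_lt.
  move=> z _; apply: (@continuous_comp _ _ _ (@cim R) (fun x : R => `|x|)).
    exact: continuous_cim.
  exact: norm_continuous.
- apply: (@open_comp _ _ (fun z : CC R => `|cim (gexp n z)|) [set x : R | x < _]);
    last exact: open_lt.
  move=> z _.
  apply: (@continuous_comp _ _ _ (gexp n) (fun w : CC R => `|cim w|)).
    exact: gexp_continuous.
  apply: (@continuous_comp _ _ _ (@cim R) (fun x : R => `|x|)).
    exact: continuous_cim.
  exact: norm_continuous.
- apply: open_comp; last exact: open_ball1.
  by move=> z _; have [cf _ _] := loc_homeo_fgexp n; exact: cf.
Qed.

Lemma standing_fgexp (sigma : nat -> nat) :
  standing_assumption (fun k => plane_triple (fgexp (sigma k))).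
Proof.
split; first by move=> k; apply: loc_homeo_pointed; exact: loc_homeo_fgexp.
exists (Some 1 : Chat R), (1 / 4); split; first lra.
move=> k; set n := sigma k; exists (section1 n @` ball1).
have B1 : ball1 1 by rewrite /ball1 /=; lra.
have s10 : section1 n 1 = 0.
  rewrite /section1 -[X in clog X]cexp0 cexpK; first by rewrite mul0r ginv0.
  by rewrite /= normr0 divr_gt0// pi_gt0.
split.
- exact: open_section1_image.
- apply: connected_continuous_connected; first exact: connected_ball1.
  by apply: continuous_in_subspaceT => w; rewrite inE; exact: section1_continuous.
- by exists 1.
- by rewrite /= fgexp0.
(* The value 0 at infinity is a default; infinity lies outside the ball. *)
exists (fun q : Chat R => if q is Some w then section1 n w else 0); split.
- apply: continuous_subspaceT => z; have [cf _ _] := loc_homeo_fgexp n.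
  exact: (continuous_comp (cf z) (@one_point_compactification_some_continuous _ _)).
- apply: continuous_in_subspaceT => q; rewrite inE => /sph_ball1[w Bw ->].
  exact: section1_continuous.
- apply/seteqP; split=> [_ [_ [w Bw <-] <-]|q /sph_ball1[w Bw ->]].
    by apply/sph_ball1; exists w => //=; rewrite section1K.
  by exists (section1 n w); [exists w|rewrite /= section1K].
- by move=> _ [w Bw <-] /=; rewrite section1K.
- by move=> _ /sph_ball1[w Bw ->] /=; rewrite section1K.
Qed.

End example.

(** * Surfaces *)

Section planar_connectedness.
Variable R : realType.
Implicit Types (z w c : CC R) (r e : R).

Lemma connected_cre_lt r : connected [set z : CC R | cre z < r].
Proof.
apply: (@star_connected _ (mkC (r - 1) 0)); first by rewrite /=; lra.
move=> w t /= wr /andP[t0 t1].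
have := mulr_ge0 t0 (ltW (_ : 0 < r - cre w)); rewrite subr_gt0 => /(_ wr); nra.
Qed.

Lemma connected_cre_gt r : connected [set z : CC R | r < cre z].
Proof.
apply: (@star_connected _ (mkC (r + 1) 0)); first by rewrite /=; lra.
move=> w t /= wr /andP[t0 t1].
have := mulr_ge0 t0 (ltW (_ : 0 < cre w - r)); rewrite subr_gt0 => /(_ wr); nra.
Qed.

Lemma connected_csquare z e : 0 <= e -> connected (csquare z e).
Proof.
move=> e0; apply: (@star_connected _ z); first by split; rewrite subrr normr0.
move=> w t [w1 w2] /andP[t0 t1]; split; rewrite /= addrC addKr normrM ger0_norm//.
  exact: le_trans (ler_piMl _ t1) w1.
exact: le_trans (ler_piMl _ t1) w2.
Qed.

Lemma cabs_fexp z : cabs (fexp z) = expR (2 * cre z).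
Proof. by rewrite cabs_cexp creM_nat. Qed.

Lemma fexp_surj c : c != 0 -> exists z, fexp z = c.
Proof.
move=> /cexp_surj[z zc]; exists (z / 2).
by rewrite /fexp mulrC divfK ?pnatr_eq0.
Qed.

(* The exponential maps a half-plane, which is convex, onto a punctured disc about 0. *)
Lemma connected_punctured_disc z e : 0 < e ->
  connected ([set w | cabs (w - z) < e] `\ z).
Proof.
move=> e0.
have -> : [set w | cabs (w - z) < e] `\ z =
    (fun w => cexp w + z) @` [set w | cre w < ln e].
  apply/seteqP; split=> [w [/= we wz]|_ [w /= we <-]].
    have : w - z != 0 by rewrite subr_eq0; exact/eqP.
    move=> /cexp_surj[v vw]; exists v; last by rewrite vw subrK.
    by rewrite /= -ltr_expR lnK ?posrE// -cabs_cexp vw.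
  split; first by rewrite /= addrK cabs_cexp -(lnK (_ : e \is Num.pos)) ?posrE// ltr_expR.
  by move=> /= /eqP; rewrite -subr_eq0 addrK (negPf (cexp_neq0 w)).
apply: connected_continuous_connected; first exact: connected_cre_lt.
apply: continuous_subspaceT => w.
by apply: continuousD; [exact: continuous_cexp|exact: cst_continuous].
Qed.

Lemma Chat_hausdorff : hausdorff_space (Chat R).
Proof.
apply: one_point_compactification_hausdorff; last exact: CC_hausdorff.
move=> z _; exists (csquare z 1); last first.
  split; first exact: compact_csquare.
  exact: compact_closed (@CC_hausdorff R) (@compact_csquare _ z 1).
by have := nbhs_csquare z (@ltr01 R); apply: filterS => w.
Qed.

Lemma nbhs_punctured z (A : set (CC R)) : nbhs z A -> exists2 w, w != z & A w.
Proof.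
move=> /nbhs_csquareP[e e0 H]; exists (z + mkC e 0).
  by rewrite -subr_eq0 addrC addKr; apply/eqP => /(congr1 (@cre R))/= E; move: e0; rewrite E ltxx.
by apply: H; split; rewrite ?creD ?cimD addrC addKr /= ?normr0 ?gtr0_norm// ltW.
Qed.

End planar_connectedness.

Section surfaces.
Variables (R : realType) (S : topologicalType).
Hypothesis surfS : open_surface R S.

(** The chart is read through its inverse [h], so that planar discs are pushed into [S], small
    enough to land in [A]. *)
Lemma surface_chart (x : S) (A : set S) : nbhs x A -> exists (z : CC R) (h : CC R -> S) (e : R),
  [/\ 0 < e /\ h z = x, {within [set w | cabs (w - z) < e], continuous h},
      h @` [set w | cabs (w - z) < e] `<=` A,
      (forall v w, cabs (v - z) < e -> cabs (w - z) < e -> h v = h w -> v = w) &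
      forall d, 0 < d -> nbhs x (h @` [set w | cabs (w - z) < d])].
Proof.
move=> xA; have [_ _ _ _ /(_ x)[U [V [g [oU Ux oV]]]]] := surfS.
move=> [h [cg ch gUV hg gh]].
have Vgx : V (g x) by rewrite -gUV; exists x.
have cgx (y : S) : U y -> {for y, continuous g}.
  by move=> Uy; move: cg; rewrite continuous_open_subspace// => /(_ y); apply; rewrite inE.
have chx (w : CC R) : V w -> {for w, continuous h}.
  by move=> Vw; move: ch; rewrite continuous_open_subspace// => /(_ w); apply; rewrite inE.
have : nbhs (g x) (V `&` h @^-1` A).
  apply: filterI; first exact: open_nbhs_nbhs.
  by apply: chx => //; rewrite hg.
move=> /nbhs_cabsP[e e0 H]; exists (g x), h, e; split => //.
- by split => //; rewrite hg.
- apply: continuous_in_subspaceT => w; rewrite inE => /H[Vw _]; exact: chx.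
- by move=> _ [w /H[_ Aw] <-].
- by move=> v w /H[Vv _] /H[Vw _] E; rewrite -(gh _ Vv) E gh.
move=> d d0.
have : nbhs x (U `&` g @^-1` [set w | cabs (w - g x) < d]).
  apply: filterI; first exact: open_nbhs_nbhs.
  by apply: cgx => //; apply/nbhs_cabsP; exists d.
by apply: filterS => y [Uy gy]; exists (g y) => //; exact: hg.
Qed.

Lemma surface_compact_nbhs (x : S) (A : set S) : nbhs x A ->
  exists K, [/\ compact K, nbhs x K & K `<=` A].
Proof.
move=> /surface_chart[z [h [e [[e0 hz] ch hA _ hn]]]].
have [d d0 sub] : exists2 d : R, 0 < d & csquare z d `<=` [set w | cabs (w - z) < e].
  by apply: nbhs_csquareP; apply/nbhs_cabsP; exists e.
exists (h @` csquare z d); split.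
- apply: continuous_compact; last exact: compact_csquare.
  exact: continuous_subspaceW sub ch.
- apply: filterS (hn d d0); apply: image_subset => w /= /ltW wd; split.
    by rewrite -creN -creD (le_trans (cre_le _)).
  by rewrite -cimN -cimD (le_trans (cim_le _)).
- by move=> _ [w /sub we <-]; apply: hA; exists w.
Qed.

Lemma surface_punctured_nbhs (x : S) (A : set S) : nbhs x A ->
  exists V, [/\ nbhs x V, V `<=` A & connected (V `\ x)].
Proof.
move=> /surface_chart[z [h [e [[e0 hz] ch hA hi hn]]]].
have De : [set w | cabs (w - z) < e] z by rewrite /= subrr cabsE /= expr0n addr0 sqrtr0.
exists (h @` [set w | cabs (w - z) < e]); split => //; first exact: hn.
have -> : (h @` [set w | cabs (w - z) < e]) `\ x = h @` ([set w | cabs (w - z) < e] `\ z).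
  apply/seteqP; split=> [_ [[w we <-] wx]|_ [w [we wz] <-]].
    by exists w => //; split => // /= wz; apply: wx; rewrite wz.
  split; first by exists w.
  by rewrite /= -hz => /(hi _ _ we De).
apply: connected_continuous_connected; first exact: connected_punctured_disc.
by apply: continuous_subspaceW ch => w [].
Qed.

End surfaces.

Lemma fixpoint_closure (S : topologicalType) (A : set S) (g : S -> S) (y : S) :
  hausdorff_space S -> {for y, continuous g} -> (forall x, A x -> g x = x) ->
  closure A y -> g y = y.
Proof.
move=> hS cg HA cAy; apply: hS => P Q gP yQ.
have nP : nbhs y (g @^-1` P) := cg P gP.
have [b [Ab [Pb Qb]]] := cAy _ (filterI nP yQ).
by exists b; split => //; rewrite -(HA b Ab).
Qed.

(** * Maximality of the limit *)

Section maximality.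
Variables (R : realType) (S : topologicalType) (f1 : S -> Chat R).
Hypothesis spread1 : spread_surface f1.
Implicit Types (z w : CC R) (O : set (Chat R)) (s : Chat R -> CC R).

(** Near a point off [E], [f1] is an embedding followed by some [fgexp], and so is locally
    injective. *)
Lemma kernel_noncritical (sigma : nat -> nat) (w1 : S) :
  kernel_cond1 (fun k => plane_triple (fgexp (sigma k))) (Triple f1 w1) ->
  exists2 E : set S, discrete_subset E & forall y, ~ E y -> noncritical f1 y.
Proof.
move=> [E [dE Ew HE]]; exists E => // y Ey.
have [U0 [yU0 U0E]] := dE y.
have [surf _ _ _] := spread1.
have [K0 [cK0 yK0 K0U]] := surface_compact_nbhs surf yU0.
(* The kernel condition concerns only compact sets containing the base point, so [w1] is
   adjoined. *)
have cK : compact (K0 `|` [set w1]) by apply: compactU => //; exact: compact_set1.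
have KE : K0 `|` [set w1] `<=` ~` E.
  by move=> x [/K0U Ux Ex|-> //]; apply: Ey; rewrite -(U0E x Ux Ex).
have [N HN] := HE _ cK KE (or_intror erefl).
have [phi [[cphi iphi _] _ fphi]] := HN N.+1 (ltnSn N).
have [_ lf _] := loc_homeo_fgexp R (sigma N.+1).
have [U [yU Ui]] := lf (phi y).
have yK : nbhs y (K0 `|` [set w1]) by apply: filterS yK0 => x; left.
have yP : nbhs y (phi @^-1` U).
  have /(_ y) := cphi; move=> /(_ U yU).
  rewrite nbhs_simpl /= -nbhs_subspace_interior; first by [].
  exact: yK.
exists ((K0 `|` [set w1]) `&` phi @^-1` U); split; first exact: filterI.
move=> a b [Ka Ua] [Kb Ub] Eab.
apply: iphi => //; apply: Ui => //; apply: Some_inj.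
have Ea := fphi a Ka; have Eb := fphi b Kb.
by rewrite /= in Ea Eb; rewrite Ea Eb.
Qed.

Variable phi : CC R -> S.
Hypothesis cphi : continuous phi.
Hypothesis iphi : injective phi.
Hypothesis fphi : forall z, f1 (phi z) = Some (fexp z).

Definition section_on O s := [/\ open O, forall q, O q -> {for q, continuous s} &
  forall q, O q -> Some (fexp (s q)) = q].

Lemma fexp_section z : exists O s,
  [/\ section_on O s, O (Some (fexp z)) & s (Some (fexp z)) = z].
Proof.
have [s [cs sz fs]] := cexp_section (2 * z).
exists (Some @` [set w | 0 < cre (w / cexp (2 * z))]),
  (fun q => if q is Some w then s w / 2 else 0); split.
- split.
  + apply: (@one_point_compactification_open_some (CC R)); exact: open_cre_gt0.
  + move=> _ [w w0 <-].
    change {for w, continuous (fun w : CC R => s w / 2)}.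
    by apply: continuousM; [exact: cs|exact: cst_continuous].
  + by move=> _ [w w0 <-]; rewrite /fexp mulrC divfK ?pnatr_eq0// fs.
- exists (fexp z) => //; change (0 < cre (fexp z / cexp (2 * z))).
  by rewrite divff ?cexp_neq0// ltr01.
- by rewrite /= sz mulrC mulKf ?pnatr_eq0.
Qed.

(** Two preimages of one value differ by a period of [fexp], so adding a constant to a branch gives
    another branch. *)
Lemma section_on_through O s z : section_on O s -> O (Some (fexp z)) ->
  exists s', section_on O s' /\ s' (Some (fexp z)) = z.
Proof.
move=> [oO cs fs] Oz; set c := z - s (Some (fexp z)).
exists (fun q => s q + c); split; last by rewrite /c addrC subrK.
split; [exact: oO| |]; move=> q Oq.
  by apply: continuousD; [exact: cs|exact: cst_continuous].
have Ez : fexp (s (Some (fexp z))) = fexp z := Some_inj (fs _ Oz).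
rewrite /fexp mulrDr cexpD mulrBr cexpB -/(fexp z) -/(fexp (s (Some (fexp z)))) -/(fexp (s q)) Ez.
by rewrite divff ?cexp_neq0// mulr1; exact: fs.
Qed.

(* With a local section [s] of [fexp], the fixed points of [phi \o s \o f1] in a punctured
   neighbourhood of [phi z] are closed by separation and open by local injectivity of [f1]. *)
Lemma phi_open : (exists2 E : set S, discrete_subset E &
    forall y, ~ E y -> noncritical f1 y) ->
  forall z A, nbhs z A -> nbhs (phi z) (phi @` A).
Proof.
move=> [E dE nE] z A zA; have [surf cf1 _ _] := spread1.
have [hS _ _ _ _] := surf.
have [Om [s [[oO cs fs] Oz sz]]] := fexp_section z.
set y := phi z; have f1y : f1 y = Some (fexp z) by exact: fphi.
have [U0 [yU0 U0E]] := dE y.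
have nO : nbhs (Some (fexp z) : Chat R) Om by exact: open_nbhs_nbhs.
have nsA : nbhs (Some (fexp z) : Chat R) (s @^-1` A).
  by apply: (cs _ Oz A); rewrite sz.
have nV : nbhs y (U0 `&` f1 @^-1` (Om `&` s @^-1` A)).
  by apply: filterI => //; apply: cf1; rewrite f1y; exact: filterI.
have [V [yV VA cV]] := surface_punctured_nbhs surf nV.
pose G := phi \o s \o f1.
have cG x : Om (f1 x) -> {for x, continuous G}.
  move=> Ox; apply: (@continuous_comp _ _ _ f1 (phi \o s)); first exact: cf1.
  by apply: (@continuous_comp _ _ _ s phi); [exact: cs|exact: cphi].
have f1G x : Om (f1 x) -> f1 (G x) = f1 x by move=> Ox; rewrite /G /= fphi fs.
pose B := (V `\ y) `&` [set x | G x = x].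
(* If [G] fixes the whole punctured neighbourhood, each [x] in it is [phi (s (f1 x))] with
   [s (f1 x)] in [A]. *)
suff BV : B = V `\ y.
  apply: filterS yV => x Vx; have [->|xy] := pselect (x = y).
    by exists z => //; exact: nbhs_singleton.
  have [_ Gx] : B x by rewrite BV.
  have [_ [_ sA]] := VA _ Vx.
  by exists (s (f1 x)).
apply: cV.
(* A value [w] near [fexp z] but different from it gives a fixed point [phi (s w)] other than
   [y]. *)
- have nW : nbhs (Some (fexp z) : Chat R) (Om `&` s @^-1` (phi @^-1` V)).
    by apply: filterI => //; apply: (cs _ Oz); rewrite sz; exact: cphi.
  have [w wz [Ow sw]] := nbhs_punctured (nW : nbhs (fexp z) (Some @^-1` _)).
  have f1w : f1 (phi (s (Some w))) = Some w by rewrite fphi fs.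
  exists (phi (s (Some w))); split; last by rewrite /G /= f1w.
  split => //= E'; move: f1w; rewrite E' f1y => -[] /esym/eqP.
  by rewrite (negPf wz).
- exists [set x | G x = x]°; first exact: open_interior.
  apply/seteqP; split=> [x [[Vx xy] Gx]|x [Vx /interior_subset Gx] //].
  split => //; have [U0x [Ox _]] := VA _ Vx.
  have [U [xU Ui]] : noncritical f1 x.
    by apply: nE => Ex; apply: xy; exact: U0E.
  have nO' : nbhs x (f1 @^-1` Om) by apply: cf1; exact: open_nbhs_nbhs.
  have nG : nbhs x (G @^-1` U) by apply: cG => //; rewrite Gx.
  rewrite /interior; apply: filterS3 xU nO' nG => x' Ux' Ox' Gx'.
  by apply: Ui => //; exact: f1G.
- exists (closure B); first exact: closed_closure.
  apply/seteqP; split=> [x Bx|x [Vx clx]].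
    by split; [case: Bx|exact: subset_closure].
  split => //=; have [_ [Ox _]] := VA _ Vx.1.
  by apply: (fixpoint_closure hS (cG x Ox) _ clx) => x' [].
Qed.

(* These translates lie in one fibre of [f1], whose points would accumulate in [K]. *)
Lemma no_translates (K : set S) z : compact K ->
  ~ (forall k : nat, K (phi (z + mkC 0 (k%:R * pi)))).
Proof.
move=> cK HK; have [_ cf1 _ df1] := spread1.
pose u (k : nat) := phi (z + mkC 0 (k%:R * pi)).
have f1u k : f1 (u k) = Some (fexp z).
  rewrite fphi /fexp mulrDr -[in RHS](cexp_period (2 * z) k); congr (Some (cexp (_ + _))).
  apply: eq_creim; first by rewrite creM_nat; exact: mulr0.
  rewrite cimM_nat; change (2 * (k%:R * pi) = k%:R * (pi *+ 2) :> R).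
  by rewrite -[pi *+ 2]mulr_natl mulrCA.
have [p [Kp up]] : K `&` cluster (u @ \oo) !=set0.
  apply: cK; suff : \oo (u @^-1` K) by [].
  by apply: filterE => k; exact: HK.
have [U [pU Up]] := df1 p.
have f1p : f1 p = Some (fexp z).
  apply/esym; apply: (@Chat_hausdorff R) => P Q /nbhs_singleton Pz Qp.
  have ufib : (u @ \oo) [set x | f1 x = Some (fexp z)] by exact: (filterE _ f1u).
  have [x [/= fx Qx]] := up _ _ ufib (cf1 p Q Qp).
  by exists (Some (fexp z)); split => //; rewrite -fx.
(* Discreteness of [f1] at the cluster point [p] forces [u k = p] for arbitrarily large [k], against
   injectivity of [phi]. *)
have key N : exists2 k, (N <= k)%N & u k = p.
  have utail : (u @ \oo) [set x | exists2 k, (N <= k)%N & u k = x].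
    by exists N => // k Nk; exists k.
  have [x [[k Nk <-] Ux]] := up _ _ utail pU.
  by exists k => //; apply: Up => //; rewrite f1u f1p.
have [k1 _ E1] := key 0%N; have [k2 k12 E2] := key k1.+1.
have /iphi/addrI/(congr1 (@cim R)) /= : u k1 = u k2 by rewrite E1 E2.
move=> /(mulIf (lt0r_neq0 (pi_gt0 R)))/eqP; rewrite eqr_nat => /eqP k1k2.
by move: k12; rewrite k1k2 ltnn.
Qed.

Lemma phi_closed (x0 : S) : closure (range phi) x0 -> exists z, phi z = x0.
Proof.
move=> clx0; have [surf cf1 _ df1] := spread1; have [hS _ _ _ _] := surf.
have [D [x0D HD]] := df1 x0.
have [K [cK x0K KD]] := surface_compact_nbhs surf x0D.
have clK : closed K by exact: compact_closed.
(* The image of the frontier of [K]; it misses [f1 x0], since [x0] is interior to [K] and the only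
   point of its fibre there. *)
set F := f1 @` (K `&` ~` K°).
have oF : open (~` F).
  apply: closed_openC; apply: compact_closed (@Chat_hausdorff R) _.
  apply: continuous_compact; first exact: continuous_subspaceT.
  by apply: compact_closedI => //; apply: open_closedC; exact: open_interior.
have nF : nbhs (f1 x0) (~` F).
  apply: open_nbhs_nbhs; split => // -[y [Ky nKy] /(HD y (KD y Ky)) yx0].
  by apply: nKy; rewrite yx0.
(* A connected set that meets [K] can leave it only through the frontier, whose values lie in
   [F]. *)
have stay (Q : set S) : connected Q -> (forall y, Q y -> ~ F (f1 y)) ->
    Q `&` K !=set0 -> Q `<=` K.
  move=> cQ QF QK; suff <- : Q `&` K = Q by move=> y [].
  apply: cQ => //; last by exists K.
  exists K°; first exact: open_interior.
  apply/seteqP; split=> [y [Qy Ky]|y [Qy /interior_subset Ky] //].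
  by split => //; apply: contrapT => nKy; apply: (QF y Qy); exists y.
have meet (P : set (Chat R)) : nbhs (f1 x0) P -> exists z, K (phi z) /\ P (Some (fexp z)).
  move=> nP; have nP' : nbhs x0 (f1 @^-1` P) := cf1 x0 P nP.
  have [_ [[z _ <-] [Kz Pz]]] := clx0 _ (filterI x0K nP').
  by exists z; split => //; rewrite -fphi.
have stay_phi (H : set (CC R)) z : connected H -> H z -> K (phi z) ->
    (forall v, H v -> ~ F (Some (fexp v))) -> forall v, H v -> K (phi v).
  move=> cH Hz Kz HF v Hv; apply: (stay (phi @` H)); last by exists v.
  - by apply: connected_continuous_connected => //; exact: continuous_subspaceT.
  - by move=> _ [v' Hv' <-]; rewrite fphi; exact: HF.
  - by exists (phi z); split => //; exists z.
have asymptotic (H : set (CC R)) z : connected H -> H z -> K (phi z) ->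
    (forall v, H v -> ~ F (Some (fexp v))) ->
    (forall k : nat, H (z + mkC 0 (k%:R * pi))) -> False.
  by move=> cH Hz Kz HF Hk; apply: (@no_translates K z cK) => k; apply: (stay_phi H z).
(* The modulus of [fexp v] depends on [cre v] alone, so discs about 0 and about infinity pull back
   to half-planes invariant under the period. *)
have fexp_cabs_gt (r : R) v : 0 < r -> (r < cabs (fexp v)) = (ln r / 2 < cre v).
  move=> r0; rewrite cabs_fexp -{1}(lnK (_ : r \is Num.pos)) ?posrE// ltr_expR.
  by rewrite ltr_pdivrMr// mulrC.
have fexp_cabs_lt (r : R) v : 0 < r -> (cabs (fexp v) < r) = (cre v < ln r / 2).
  move=> r0; rewrite cabs_fexp -{1}(lnK (_ : r \is Num.pos)) ?posrE// ltr_expR.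
  by rewrite ltr_pdivlMr// mulrC.
case Ea : (f1 x0) => [a|]; rewrite Ea in nF meet; last first.
  exfalso; case: nF => C [cC _] CF.
  have [M HM] := compact_cabs_bounded cC.
  (* [M.+1] rather than [M] keeps the radius positive, as its logarithm requires. *)
  have M0 : 0 < M.+1%:R :> R by rewrite ltr0n.
  have [|z [Kz Mz]] := meet
      [set q | if q is Some w then M.+1%:R < cabs (w : CC R) else True].
    exists (csquare 0 M.+1%:R).
      split; first exact: compact_csquare.
      exact: compact_closed (@CC_hausdorff R) (@compact_csquare _ 0 _).
    move=> _ [[w /= nw <-]|-> //]; rewrite ltNge; apply/negP => wM; apply: nw.
    by split; rewrite subr0 (le_trans _ wM)// ?cre_le ?cim_le.
  apply: (@asymptotic [set v | ln M.+1%:R / 2 < cre v] z) => //.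
  - exact: connected_cre_gt.
  - by rewrite /= -fexp_cabs_gt.
  - move=> v; rewrite /= -fexp_cabs_gt// => vM; apply: CF; left.
    exists (fexp v) => // /HM; rewrite ltNge => /negP; apply.
    by rewrite (le_trans _ (ltW vM))// ler_nat.
  - by move=> k; rewrite /= creD addr0 -fexp_cabs_gt.
have [a0|a0] := eqVneq a 0.
  exfalso; rewrite a0 in nF meet.
  have /nbhs_cabsP[d d0 Hd] : nbhs (0 : CC R) (Some @^-1` (~` F)) by exact: nF.
  have [|z [Kz dz]] := meet [set q | if q is Some w then cabs (w : CC R) < d else False].
    suff : nbhs (0 : CC R) [set w | cabs w < d] by [].
    by apply/nbhs_cabsP; exists d => // w; rewrite subr0.
  apply: (@asymptotic [set v | cre v < ln d / 2] z) => //.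
  - exact: connected_cre_lt.
  - by rewrite /= -fexp_cabs_lt.
  - by move=> v; rewrite /= -fexp_cabs_lt// => vd; apply: Hd; rewrite subr0.
  - by move=> k; rewrite /= creD addr0 -fexp_cabs_lt.
have [z0 fz0] := fexp_surj a0.
have [Om [s [son Oz0 _]]] := fexp_section z0.
have [oO _ _] := son.
have /nbhs_csquareP[e e0 He] : nbhs a (Some @^-1` (Om `&` ~` F)).
  suff : nbhs (Some a : Chat R) (Om `&` ~` F) by [].
  by apply: filterI => //; apply: open_nbhs_nbhs; rewrite -fz0.
have [|z [Kz ez]] := meet [set q | if q is Some w then csquare a e w else False].
  by suff : nbhs a (csquare a e) by []; exact: nbhs_csquare.
have Oz : Om (Some (fexp z)) by have [] := He _ ez.
have [s' [[_ cs' fs'] sz']] := section_on_through son Oz.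
have fs'w w : csquare a e w -> fexp (s' (Some w)) = w.
  by move=> /He[Ow _]; exact: Some_inj (fs' _ Ow).
have ca : csquare a e a by split; rewrite subrr normr0 ltW.
(* The branch carries the square to a connected set containing [z], on which [fexp] avoids [F];
   hence [phi] keeps it in [K]. Over [a], [HD] then identifies the point with [x0]. *)
have Ka : K (phi (s' (Some a))).
  apply: (@stay_phi ((fun w => s' (Some w)) @` csquare a e) z) => //.
  - apply: connected_continuous_connected; first exact/connected_csquare/ltW.
    apply: continuous_in_subspaceT => w; rewrite inE => /He[Ow _].
    exact: cs' Ow.
  - by exists (fexp z).
  - by move=> _ [w ew <-]; rewrite fs'w//; have [] := He _ ew.
  - by exists a.
exists (s' (Some a)); apply: HD; first exact: KD.
by rewrite fphi Ea fs'w.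
Qed.

(** The range is nonempty, open and closed in the connected [S], so [phi] is onto; openness of [phi]
    makes the inverse continuous. *)
Lemma phi_homeomorphism : (exists2 E : set S, discrete_subset E &
    forall y, ~ E y -> noncritical f1 y) -> homeomorphism phi.
Proof.
move=> HE; have op := phi_open HE.
have [[hS _ cS _ _] _ _ _] := spread1.
have oR : open (range phi).
  rewrite openE => _ [z _ <-]; apply: filterS (op z _ filterT) => _ [w _ <-].
  by exists w.
have RT : range phi = setT.
  apply: cS; first by exists (phi 0), 0.
  - by exists (range phi); rewrite ?setTI.
  - exists (closure (range phi)); first exact: closed_closure.
    rewrite setTI; apply/seteqP; split; first exact: subset_closure.
    by move=> x /phi_closed[z <-]; exists z.
have surj x : {z | phi z = x}.
  have Rx : range phi x by rewrite RT.
  by apply: cid; have [z _ <-] := Rx; exists z.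
pose g x := sval (surj x).
have gK x : phi (g x) = x by exact: svalP (surj x).
have Kg z : g (phi z) = z by apply: iphi; rewrite gK.
exists g; split; [exact: cphi| |exact: Kg|exact: gK].
move=> x A gA; suff : nbhs x (g @^-1` A) by [].
have := op (g x) A gA; rewrite gK; apply: filterS => _ [z Az <-].
by change (A (g (phi z))); rewrite Kg.
Qed.

End maximality.

Theorem theorem5p1 (R : realType) :
  exists (fn : nat -> CC R -> CC R) (f : CC R -> CC R),
    [/\ forall n, [/\ entire (fn n), normalized_plane (fn n) &
                      entire_order (fn n) = +oo%E],
        entire f, normalized_plane f, entire_order f = 1%E &
        caratheodory_converges (fun n => plane_triple (fn n)) (plane_triple f)].
Proof.
exists (@fgexp R), (@fexp R); split.
- move=> n; split; [|exact: normalized_fgexp|exact: order_fgexp].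
  by move=> z; have [] := is_derive_fgexp n z.
- by move=> z; have [] := is_derive_fexp z.
- exact: normalized_fexp.
- exact: order_fexp.
split; first exact: (standing_fgexp R id).
move=> sigma Hsigma; split.
- by have [] := normalized_fexp R.
- exact: kernel_cond1_fexp.
move=> [S f1 w1] [spread1 _] ker1 [phi [cphi iphi phi0 fphi]].
exists phi; split => //.
apply: (phi_homeomorphism spread1 cphi iphi) => [z|]; first exact/esym/fphi.
exact: (kernel_noncritical spread1 ker1).
Qed.
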